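(* Let $r\in\mathbb{R}$ and let $\lambda$ be a partition of $n$. If $(\mathcal{F},v)\in I_r^d$ satisfies $\mathcal{O}(\mathcal{F},v)\subset\mathcal{O}_\lambda(k)$, then $$\dim\mathcal{F}=|\lambda|-1,$$ where $|\lambda|$ denotes the number of parts, counted with multiplicity, in the partition $\lambda$.
   Context: Field and group. $k$ is a non-Archimedean local field with algebraic closure $K$, integer ring $\mathcal{R}$, maximal ideal $\mathcal{P}$, normalized valuation $\mathrm{val}$, and finite residue field $\mathfrak{f}$ of characteristic $p_{\mathfrak f}>3(n-1)$; $n\ge2$. $G=\mathrm{SL}_n(k)$, $\mathfrak{g}=\mathfrak{sl}_n(k)$, $\mathbb{T}$ is the diagonal torus, $\mathfrak{t}$ its Lie algebra over $k$. $\mathcal{O}_\lambda$ is the $\mathrm{SL}_n(K)$-orbit of nilpotent matrices in $\mathfrak{sl}_n(K)$ with Jordan block sizes given by $\lambda$, and $\mathcal{O}_\lambda(k)=\mathcal{O}_\lambda\cap\mathfrak{g}$. Filtrations. $\mathcal{B}(G)$ is the Bruhat-Tits building and $\mathcal{A}\subset\mathcal{B}(G)$ the apartment of $\mathbb{T}$, identified with $X_*(\mathbb{T})\otimes\mathbb{R}=\{x\in\mathbb{R}^n:\sum_i x_i=0\}$, with coordinate functions $e_i$. Roots: $\Phi=\{e_i-e_j:i\ne j\}$, with root space of $e_i-e_j$ the matrices supported at entry $(i,j)$. Affine roots: $\Psi=\{\phi+m:\phi\in\Phi,m\in\mathbb{Z}\}$, with $(\phi+m)(x)=\phi(x)+m$;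 $\mathfrak{g}_{\phi+m}$ is the set of elements of the root space $\mathfrak{g}_\phi$ with entries in $\mathcal{P}^m$. For $x\in\mathcal{A}$, $r\in\mathbb{R}$: $\mathfrak{t}_r=\{H\in\mathfrak{t}:\mathrm{val}(d\chi(H))\ge r\ \forall\chi\in X^*(\mathbb{T})\}$, $\mathfrak{g}_{x,r}=\mathfrak{t}_r\oplus\sum_{\psi(x)\ge r}\mathfrak{g}_\psi$, and $\mathfrak{g}_{x,r+}$ is defined with strict inequalities. These extend to $x\in\mathcal{B}(G)$ by $\mathfrak{g}_{gx,r}=\mathrm{Ad}(g)\mathfrak{g}_{x,r}$. $V_{x,r}=\mathfrak{g}_{x,r}/\mathfrak{g}_{x,r+}$, an $\mathfrak{f}$-vector space. Facets. For $\psi\in\Psi$, $H_{\psi-r}=\{x\in\mathcal{A}:\psi(x)=r\}$. For a finite subset $\Sigma\subseteq\Psi$, let $H_\Sigma=\bigcap_{\psi\in\Sigma}H_{\psi-r}$. An $r$-facet of $\mathcal{A}$ is a connected component of $H_\Sigma\setminus\bigcup_{\psi\in\Psi\setminus\Sigma}H_{\psi-r}$ for some $\Sigma$; its dimension is that of the smallest affine subspace of $\mathcal{A}$ containing it. The spaces $\mathfrak{g}_{x,r}$, $\mathfrak{g}_{x,r+}$ are constant for $x$ in an $r$-facet $\mathcal{F}$; write $\mathfrak{g}_{\mathcal F}=\mathfrak{g}_{x,r}$, $V_{\mathcal F}=V_{x,r}$. The generalized $r$-facet containing $x\in\mathcal{B}(G)$ is the set of $y\in\mathcal{B}(G)$ with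 $\mathfrak{g}_{x,r}=\mathfrak{g}_{y,r}$ and $\mathfrak{g}_{x,r+}=\mathfrak{g}_{y,r+}$; its nonempty intersections with apartments are $r$-facets of one common dimension, which is its dimension. $\mathcal{F}^{\mathcal B}$ denotes the generalized $r$-facet containing $\mathcal{F}$. Pairs and orbits. $v\in V_{\mathcal F}$ is degenerate if it is the image of a nilpotent element of $\mathfrak{g}_{\mathcal F}$; $I_r^n$ is the set of pairs $(\mathcal{F},v)$ with $\mathcal{F}$ an $r$-facet of $\mathcal{A}$ and $v\in V_{\mathcal F}$ degenerate. A Lie triple is $(Y,H,X)$ with $[H,X]=2X$, $[H,Y]=-2Y$, $[X,Y]=H$. For $(\mathcal{F},v)\in I_r^n$ with $v\ne0$ and $x\in\mathcal{F}$, extend $v$ to a Lie triple $(w,h,v)\in V_{x,-r}\times V_{x,0}\times V_{x,r}$ and lift it to a Lie triple $(Y,H,X)\in\mathfrak{g}_{x,-r}\times\mathfrak{g}_{x,0}\times\mathfrak{g}_{x,r}$ over $k$; then $\mathcal{O}(\mathcal{F},v)=\mathrm{Ad}(G)X$, which (DeBacker) is independent of choices and is the unique nilpotent orbit of minimal dimension meeting the coset $v=X+\mathfrak{g}_{x,r+}$. If $v=0$, $\mathcal{O}(\mathcal{F},v)=\{0\}$ and the triple is $(0,0,0)$. For a Lie triple $(Y,H,X)$, $\mathcal{B}_r(Y,H,X)=\{x\in\mathcal{B}(G):Y\in\mathfrak{g}_{x,-r},X\in\mathfrak{g}_{x,r}\}$, a union of generalized $r$-facets. $(\mathcal{F},v)\in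 I_r^n$ is distinguished if, for a Lie triple $(Y,H,X)\in\mathfrak{g}_{x,-r}\times\mathfrak{g}_{x,0}\times\mathfrak{g}_{x,r}$ over $k$ (with $x\in\mathcal{F}$) lifting a Lie triple $(w,h,v)\in V_{x,-r}\times V_{x,0}\times V_{x,r}$ that extends $v$ (and $(Y,H,X)=(0,0,0)$ if $v=0$), $\mathcal{F}^{\mathcal B}$ is a generalized $r$-facet of maximal dimension in $\mathcal{B}_r(Y,H,X)$. $I_r^d$ is the set of distinguished pairs. *)

(* Defs.v *)
From HB Require Import structures.
From mathcomp Require Import all_boot all_order all_algebra perm.
From mathcomp Require Import all_classical all_reals all_analysis.
Set Implicit Arguments.
Unset Strict Implicit.
Unset Printing Implicit Defensive.
Import Order.TTheory GRing.Theory Num.Theory.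
Import numFieldNormedType.Exports.
Local Open Scope classical_set_scope.
Local Open Scope ring_scope.

(** * Non-Archimedean local fields *)

(* [lf_val] is the normalized valuation on nonzero elements; its value at 0 is
   irrelevant, the convention val 0 = +oo being built into [val_ge]/[val_gt].
   The residue field is given by the reduction map [lf_red], which only matters
   on the integer ring {a | a = 0 or val a >= 0}. *)
Record local_field := LocalField {
  lf_field :> fieldType;
  lf_val : lf_field -> int;
  residue : finFieldType;
  lf_red : lf_field -> residue;
  int_ring := [set a : lf_field | a = 0 \/ 0 <= lf_val a];
  max_ideal := [set a : lf_field | a = 0 \/ 0 < lf_val a];
  lf_valM : forall a b, a != 0 -> b != 0 -> lf_val (a * b) = lf_val a + lf_val b;
  lf_valD : forall a b, a != 0 -> b != 0 -> a + b != 0 ->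
    Num.min (lf_val a) (lf_val b) <= lf_val (a + b);
  lf_val_normalized : exists2 a, a != 0 & lf_val a = 1;
  lf_complete : forall u : nat -> lf_field,
    (forall N : int, exists m0 : nat, forall m l : nat, (m0 <= m)%N -> (m0 <= l)%N ->
       u m - u l = 0 \/ N <= lf_val (u m - u l)) ->
    exists a, forall N : int, exists m0 : nat, forall m : nat, (m0 <= m)%N ->
       u m - a = 0 \/ N <= lf_val (u m - a);
  lf_redD : forall a b, int_ring a -> int_ring b ->
    lf_red (a + b) = lf_red a + lf_red b;
  lf_redM : forall a b, int_ring a -> int_ring b ->
    lf_red (a * b) = lf_red a * lf_red b;
  lf_red1 : lf_red 1 = 1;
  lf_red_surj : forall c : residue, exists2 a, int_ring a & lf_red a = c;
  lf_red_ker : forall a, int_ring a -> (lf_red a = 0 <-> max_ideal a)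
}.

Definition val_ge (R : realType) (k : local_field) (r : R) (a : k) : Prop :=
  a = 0 \/ r <= (lf_val a)%:~R.
Definition val_gt (R : realType) (k : local_field) (r : R) (a : k) : Prop :=
  a = 0 \/ r < (lf_val a)%:~R.

(* The fractional ideal P^m. *)
Definition ideal_pow (k : local_field) (m : int) : set k :=
  [set a | a = 0 \/ m <= lf_val a].

(** * Linear algebra *)

Definition SL (F : fieldType) (n : nat) : set 'M[F]_n := [set g | \det g = 1].
Arguments SL : clear implicits.
Definition sl (F : fieldType) (n : nat) : set 'M[F]_n := [set A | \tr A = 0].
Arguments sl : clear implicits.

Definition Ad (F : fieldType) (n : nat) (g A : 'M[F]_n) : 'M[F]_n :=
  g *m A *m invmx g.
Definition lie_br (F : fieldType) (n : nat) (A B : 'M[F]_n) : 'M[F]_n :=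
  A *m B - B *m A.

Definition nilpotent_mx (F : fieldType) (n : nat) (A : 'M[F]_n) : Prop :=
  exists m : nat, A ^+ m = 0.

Definition lie_triple (F : fieldType) (n : nat) (Y H X : 'M[F]_n) : Prop :=
  [/\ lie_br H X = X *+ 2, lie_br H Y = Y *- 2 & lie_br X Y = H].

Definition is_partition (lam : seq nat) (n : nat) : Prop :=
  [/\ sorted geq lam, 0%N \notin lam & sumn lam = n].

(* Block diagonal nilpotent Jordan matrix: 1 at (i, i+1), except where a new
   block begins at i+1, i.e. where i+1 is a partial sum of lam. *)
Definition jordan_mx (F : fieldType) (n : nat) (lam : seq nat) : 'M[F]_n :=
  \matrix_(i, j) ((j == i.+1 :> nat) && (val j \notin scanl addn 0%N lam))%:R.
Arguments jordan_mx : clear implicits.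

Definition orbit_part (K : fieldType) (n : nat) (lam : seq nat) : set 'M[K]_n :=
  [set Ad g (jordan_mx K n lam) | g in SL K n].
Arguments orbit_part : clear implicits.

Definition orbit_part_rat (k K : fieldType) (iota : k -> K) (n : nat)
    (lam : seq nat) : set 'M[k]_n :=
  [set A | sl k n A /\ orbit_part K n lam (map_mx iota A)].
Arguments orbit_part_rat {k K} iota n lam _.

(** * The standard apartment and its facets *)

Definition apartment (R : realType) (n : nat) : set 'rV[R]_n :=
  [set x | \sum_i x 0 i = 0].
Arguments apartment : clear implicits.

(* (i, j, m) stands for e_i - e_j + m. *)
Definition affine_root (n : nat) : Type := ('I_n * 'I_n * int)%type.
Definition affine_roots (n : nat) : set (affine_root n) :=
  [set psi | psi.1.1 != psi.1.2].
Arguments affine_roots : clear implicits.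
Definition aff_eval (R : realType) (n : nat) (psi : affine_root n)
    (x : 'rV[R]_n) : R :=
  x 0 psi.1.1 - x 0 psi.1.2 + psi.2%:~R.

Definition facet_locus (R : realType) (n : nat) (r : R)
    (Sigma : set (affine_root n)) : set 'rV[R]_n :=
  [set x | [/\ apartment R n x,
    forall psi, Sigma psi -> aff_eval psi x = r &
    forall psi, affine_roots n psi -> ~ Sigma psi -> aff_eval psi x <> r]].

Definition r_facet (R : realType) (n : nat) (r : R) (F : set 'rV[R]_n) : Prop :=
  exists Sigma : set (affine_root n), exists x : 'rV[R]_n,
    [/\ finite_set Sigma, Sigma `<=` affine_roots n, facet_locus r Sigma x &
        F = connected_component (facet_locus r Sigma) x].

Definition affine_subspace (R : realType) (n : nat) (p : 'rV[R]_n)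
    (U : {vspace 'rV[R]_n}) : set 'rV[R]_n :=
  [set x | x - p \in U].

(* For a subset of the apartment, the smallest affine subspace of R^n
   containing it lies in the apartment. *)
Definition has_dim (R : realType) (n : nat) (F : set 'rV[R]_n) (d : nat) : Prop :=
  exists p : 'rV[R]_n, exists U : {vspace 'rV[R]_n},
    [/\ F `<=` affine_subspace p U,
        forall (p' : 'rV[R]_n) (U' : {vspace 'rV[R]_n}),
          F `<=` affine_subspace p' U' ->
          affine_subspace p U `<=` affine_subspace p' U' &
        \dim U = d].

(** * Filtrations at points of the apartment *)

(* A character of the torus is a vector c of integers (modulo the constant
   ones), with differential H |-> sum_i c_i H_ii. *)
Definition dchar (k : local_field) (n : nat) (c : 'I_n -> int) (A : 'M[k]_n) : k :=
  \sum_i A i i *~ c i.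

(* The torus and root components of a matrix are its diagonal and its
   off-diagonal entries; the (i, j) component must lie in some g_psi with
   psi = e_i - e_j + m and psi(x) >= r. *)
Definition filt (R : realType) (k : local_field) (n : nat) (x : 'rV[R]_n)
    (r : R) : set 'M[k]_n :=
  [set A | [/\ sl k n A,
    forall c : 'I_n -> int, val_ge r (dchar c A) &
    forall i j : 'I_n, i != j -> exists2 m : int,
      r <= aff_eval (i, j, m) x & ideal_pow m (A i j)]].
Arguments filt {R} k {n} _ _ _.

Definition filt_plus (R : realType) (k : local_field) (n : nat) (x : 'rV[R]_n)
    (r : R) : set 'M[k]_n :=
  [set A | [/\ sl k n A,
    forall c : 'I_n -> int, val_gt r (dchar c A) &
    forall i j : 'I_n, i != j -> exists2 m : int,
      r < aff_eval (i, j, m) x & ideal_pow m (A i j)]].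
Arguments filt_plus {R} k {n} _ _ _.

(* V_{x,r}, as the set of cosets of g_{x,r+} in g_{x,r}; its zero is
   [filt_plus k x r]. *)
Definition coset (R : realType) (k : local_field) (n : nat) (x : 'rV[R]_n)
    (r : R) (A : 'M[k]_n) : set 'M[k]_n :=
  [set B | filt_plus k x r (B - A)].
Definition quot (R : realType) (k : local_field) (n : nat) (x : 'rV[R]_n)
    (r : R) : set (set 'M[k]_n) :=
  [set coset x r A | A in filt k x r].
Arguments quot {R} k {n} _ _ _.

(* The induced operations; r is the level of the result. *)
Definition quot_br (R : realType) (k : local_field) (n : nat) (x : 'rV[R]_n)
    (r : R) (a b : set 'M[k]_n) : set 'M[k]_n :=
  \bigcup_(A in a) \bigcup_(B in b) coset x r (lie_br A B).
Definition quot_mulz (R : realType) (k : local_field) (n : nat) (x : 'rV[R]_n)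
    (r : R) (a : set 'M[k]_n) (m : int) : set 'M[k]_n :=
  \bigcup_(A in a) coset x r (A *~ m).

Definition quot_lie_triple (R : realType) (k : local_field) (n : nat)
    (x : 'rV[R]_n) (r : R) (w h v : set 'M[k]_n) : Prop :=
  [/\ quot k x (- r) w, quot k x 0 h & quot k x r v] /\
  [/\ quot_br x r h v = quot_mulz x r v 2,
      quot_br x (- r) h w = quot_mulz x (- r) w (- 2) &
      quot_br x 0 v w = h].

(* (Y, H, X) is a Lie triple over k attached to v in V_{x,r}. *)
Definition adapted_triple (R : realType) (k : local_field) (n : nat)
    (x : 'rV[R]_n) (r : R) (v : set 'M[k]_n) (Y H X : 'M[k]_n) : Prop :=
  (v = filt_plus k x r /\ [/\ Y = 0, H = 0 & X = 0]) \/
  (v <> filt_plus k x r /\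
   lie_triple Y H X /\
   exists w h : set 'M[k]_n,
     quot_lie_triple x r w h v /\ [/\ w Y, h H & v X]).

(** * The Bruhat-Tits building *)

(* The building is G x A modulo (g, x) ~ (h, y) iff there is n in N(T) with
   y = n.x and g^-1 h n in the stabilizer G_x. *)

(* m is monomial, sends the line of e_j to that of e_(s j), and acts on the
   apartment by x |-> y; the signs are those for which
   Ad m g_{x,r} = g_{m.x,r}. *)
Definition normalizer_act (R : realType) (k : local_field) (n : nat)
    (m : 'M[k]_n) (x y : 'rV[R]_n) : Prop :=
  exists s : {perm 'I_n},
    (forall i j, (m i j != 0) = (i == s j)) /\
    (forall j, y 0 (s j) = x 0 j - (lf_val (m (s j) j))%:~R).

(* G_x, generated by the integral points of T and the root groups of the affine
   roots that are nonnegative at x. *)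
Definition stabilizer (R : realType) (k : local_field) (n : nat)
    (x : 'rV[R]_n) : set 'M[k]_n :=
  [set g | SL k n g /\ forall i j, val_ge (x 0 j - x 0 i) (g i j)].
Arguments stabilizer {R} k {n} _ _.

Definition building_pt (R : realType) (k : local_field) (n : nat) : Type :=
  set ('M[k]_n * 'rV[R]_n).

(* The class of (g, x), i.e. the point g.x of the building. *)
Definition bpoint (R : realType) (k : local_field) (n : nat)
    (g : 'M[k]_n) (x : 'rV[R]_n) : building_pt R k n :=
  [set hy | [/\ SL k n hy.1, apartment R n hy.2 &
     exists m : 'M[k]_n, [/\ SL k n m, normalizer_act m x hy.2 &
       stabilizer k x (invmx g *m hy.1 *m m)]]].

Definition building (R : realType) (k : local_field) (n : nat) :
    set (building_pt R k n) :=
  [set y | exists g : 'M[k]_n, exists x : 'rV[R]_n,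
     [/\ SL k n g, apartment R n x & y = bpoint g x]].
Arguments building : clear implicits.

Definition bfilt (R : realType) (k : local_field) (n : nat)
    (y : building_pt R k n) (r : R) : set 'M[k]_n :=
  [set A | exists g : 'M[k]_n, exists x : 'rV[R]_n,
     [/\ SL k n g, apartment R n x, y = bpoint g x &
         (Ad g @` filt k x r) A]].
Definition bfilt_plus (R : realType) (k : local_field) (n : nat)
    (y : building_pt R k n) (r : R) : set 'M[k]_n :=
  [set A | exists g : 'M[k]_n, exists x : 'rV[R]_n,
     [/\ SL k n g, apartment R n x, y = bpoint g x &
         (Ad g @` filt_plus k x r) A]].

Definition gen_facet (R : realType) (k : local_field) (n : nat) (r : R)
    (C : set (building_pt R k n)) : Prop :=
  exists2 y, building R k n y &
    C = [set z | [/\ building R k n z, bfilt z r = bfilt y r &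
                     bfilt_plus z r = bfilt_plus y r]].

(* The intersection of C with the apartment g.A, transported to A by g^-1. *)
Definition apt_section (R : realType) (k : local_field) (n : nat)
    (C : set (building_pt R k n)) (g : 'M[k]_n) : set 'rV[R]_n :=
  [set x | apartment R n x /\ C (bpoint g x)].

(* The dimension of a generalized facet is the common dimension of its nonempty
   intersections with apartments. *)
Definition gen_facet_dim (R : realType) (k : local_field) (n : nat)
    (C : set (building_pt R k n)) (d : nat) : Prop :=
  exists g : 'M[k]_n,
    [/\ SL k n g, apt_section C g !=set0 & has_dim (apt_section C g) d].

Definition triple_locus (R : realType) (k : local_field) (n : nat) (r : R)
    (Y H X : 'M[k]_n) : set (building_pt R k n) :=
  [set y | [/\ building R k n y, bfilt y (- r) Y & bfilt y r X]].

Definition max_gen_facet (R : realType) (k : local_field) (n : nat) (r : R)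
    (B C : set (building_pt R k n)) : Prop :=
  [/\ gen_facet r C, C `<=` B &
      forall C' : set (building_pt R k n), gen_facet r C' -> C' `<=` B ->
        forall d d' : nat, gen_facet_dim C d -> gen_facet_dim C' d' ->
          (d' <= d)%N].

(** * Pairs and orbits *)

(* A pair (F, v) belongs to I_r^n; V_F is V_{x,r} for any x in F. *)
Definition degenerate_pair (R : realType) (k : local_field) (n : nat) (r : R)
    (F : set 'rV[R]_n) (v : set 'M[k]_n) : Prop :=
  r_facet r F /\
  exists x : 'rV[R]_n, exists A : 'M[k]_n,
    [/\ F x, filt k x r A, nilpotent_mx A & v = coset x r A].

(* O(F, v) = Ad(G) X for a triple attached to v; the orbit does not depend on
   x or on the triple, so the union over all choices is this single orbit. *)
Definition pair_orbit (R : realType) (k : local_field) (n : nat) (r : R)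
    (F : set 'rV[R]_n) (v : set 'M[k]_n) : set 'M[k]_n :=
  [set Z | exists x : 'rV[R]_n, exists Y H X g : 'M[k]_n,
     [/\ F x, adapted_triple x r v Y H X, SL k n g & Z = Ad g X]].

(* A pair (F, v) belongs to I_r^d; C is the generalized facet containing F. *)
Definition distinguished_pair (R : realType) (k : local_field) (n : nat) (r : R)
    (F : set 'rV[R]_n) (v : set 'M[k]_n) : Prop :=
  degenerate_pair r F v /\
  exists x : 'rV[R]_n, exists Y H X : 'M[k]_n,
    [/\ F x, adapted_triple x r v Y H X &
        exists C : set (building_pt R k n),
          [set bpoint (1%:M : 'M[k]_n) y | y in F] `<=` C /\
          max_gen_facet r (triple_locus r Y H X) C].

(* Main.v *)
Require Import Defs.
From HB Require Import structures.
From mathcomp Require Import all_boot all_order all_algebra perm.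
From mathcomp Require Import all_classical all_reals all_analysis.
From mathcomp Require Import zify ring lra.
Set Implicit Arguments.
Unset Strict Implicit.
Unset Printing Implicit Defensive.
Import Order.TTheory GRing.Theory Num.Theory.
Import numFieldNormedType.Exports.
Local Open Scope classical_set_scope.
Local Open Scope ring_scope.

(** Let x be a point of F and (Y, H, X) the triple through which (F, v) is
    distinguished; put ell = n - rank X, which is the number of parts of lambda
    because X is conjugate to a Jordan matrix of type lambda. The theorem says
    that F has dimension ell - 1, and the two inequalities have different
    sources. Vectors are rows throughout, acted upon from the right; in this
    action [X, Y] = H makes the kernel of Y the space of highest-weight vectors
    and lets X lower the weight by 2.

    Chains. The residue characteristic exceeds 2 n, so that the classical
    representation theory of sl_2 is available over k: X and Y are nilpotent
    ([weight_nilpotent]), H is diagonalizable on ker Y with weights 0, ...,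
    n - 1 ([kerY_eigenbasis]), and ker Y is a complement of im X
    ([kerY_imX_disjoint], [lie_triple_rank]). Hence k^n has a basis made of ell
    chains u, u X, u X^2, ..., on which Y moves backwards with integral
    coefficients ([chain_basis]).

    Facets. The dimension of a facet is read off the graph on the coordinates
    1, ..., n that joins i and j when the point lies on a wall of direction
    e_i - e_j: the point can move exactly in the directions that are constant
    on the connected components, so with q components the dimension is q - 1
    ([same_side_has_dim], [face_components]). The intersection of a generalized
    facet with an apartment is the set of points with the same signs
    ([apt_section_same_side]); that set is convex, hence connected, and so it
    is F for the standard apartment.

    At least ell - 1. In the apartment of a chain basis, the points at which X
    and Y satisfy the two depth conditions include those whose coordinate
    decreases by r along every chain: a family with one free parameter per
    chain. A generic member lies only on walls joining two vectors of the same
    chain ([generic_point]), so its facet has at least ell components. The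
    generalized facet through it stays in the locus of the triple because
    g_{x,-r} is the dual of g_{x,r+} under the trace form ([filt_dual],
    [bfilt_dual]). This gives [large_facet_in_locus], and maximality gives
    dim F >= ell - 1.

    At most ell - 1. Let q be the number of components at x. Modulo higher
    depth, X preserves the span of the coordinates of each component, and it is
    nilpotent there; so each component carries a vector that X moves deeper
    than expected ([residual_kernel_vector]). A product of factors
    1 - (a b)^-1 X Y sends k^n into ker X ([kernel_correctorX]); as the a b are
    units, it is 1 + X M with M of depth -r ([kernel_corrector_integral]), so
    it changes these q vectors only by deeper terms. The corrected vectors lie
    in ker X and remain independent, because their leading terms sit in
    different components. Thus q <= ell ([component_count_le]). *)

(** * Nilpotency in sl_2-triples *)

Lemma commutator_exp (F : fieldType) (n : nat) (A H : 'M[F]_n.+1) (c : F) (m : nat) :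
  H * A = A * H + c *: A -> H * A ^+ m = A ^+ m * H + (c *+ m) *: A ^+ m.
Proof.
move=> HA; elim: m => [|m IHm]; first by rewrite expr0 mulr1 mul1r mulr0n scale0r addr0.
rewrite exprSr mulrA IHm mulrDl -mulrA HA mulrDr mulrA -addrA; congr (_ + _).
by rewrite -scalerAl -scalerAr -scalerDl mulrSr addrC.
Qed.

(** Taking the commutator with H is a derivation that scales A by c, hence it
    acts on polynomials in A as c X d/dX. *)
Lemma commutator_horner (F : fieldType) (n : nat) (A H : 'M[F]_n.+1) (c : F) (p : {poly F}) :
  H * A = A * H + c *: A ->
  H * horner_mx A p = horner_mx A p * H + c *: horner_mx A ('X * p^`()).
Proof.
move=> HA; elim/poly_ind: p => [|p a IHp].
  by rewrite deriv0 mulr0 !rmorph0 mulr0 mul0r scaler0 addr0.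
rewrite derivMXaddC mulrDr !(rmorphD, rmorphM) /= horner_mx_X horner_mx_C.
set P := horner_mx A p in IHp *; set Q := horner_mx A p^`() in IHp *.
have hC q : A * horner_mx A q = horner_mx A q * A.
  by have := rmorphM (horner_mx A) 'X q; rewrite mulrC rmorphM /= horner_mx_X => ->.
have AP : A * P = P * A by exact: hC.
have AQ : A * Q = Q * A by exact: hC.
rewrite rmorphM /= horner_mx_X -/Q in IHp.
have HPA : H * (P * A) = P * (A * H) + P * (c *: A) + c *: (A * Q * A).
  by rewrite mulrA IHp mulrDl -(mulrA P H) HA mulrDr -scalerAl.
rewrite mulrDr mulrDl HPA -mulrA (_ : H * a%:M = a%:M * H);
  last by rewrite -[LHS]/(H *m _) scalar_mxC.
by rewrite scalerDr -scalerAr AP -!mulrA -!addrA; congr (_ + _); rewrite [RHS]addrC !addrA.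
Qed.

(** Let p be the minimal polynomial of A and d <= n + 1 its degree. By
    [commutator_horner], p divides X p', whose degree is at most d; so
    X p' = d p, and since d - i is invertible for i < d, only the leading
    monomial of p survives. *)
Lemma weight_nilpotent (F : fieldType) (n : nat) (A H : 'M[F]_n.+1) (c : F) :
  (forall m, (0 < m <= n.+1)%N -> m%:R != 0 :> F) -> c != 0 ->
  H * A = A * H + c *: A -> A ^+ n.+1 = 0.
Proof.
move=> hF c0 HA; set p := mxminpoly A; set d := degree_mxminpoly A.
have szp : size p = d.+1 by exact: size_mxminpoly.
have pmon : p \is monic by exact: mxminpoly_monic.
have dn : (d <= n.+1)%N.
  have := dvdp_leq (monic_neq0 (char_poly_monic A)) (mxminpoly_dvd_char A).
  by rewrite szp size_char_poly ltnS.
have hp0 : horner_mx A p = 0 by exact: mx_root_minpoly.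
have := commutator_horner p HA; rewrite hp0 mulr0 mul0r add0r => /esym/eqP.
rewrite scaler_eq0 (negPf c0) /= => /eqP /mxminpoly_min dvd1.
pose q := 'X * p^`() - d%:R *: p.
have dvd2 : p %| q by apply: dvdp_sub => //; rewrite -mul_polyC dvdp_mulIr.
have qE i : q`_i = p`_i *+ i - d%:R * p`_i.
  by rewrite coefB coefZ coefXM coef_deriv; case: i.
have szq : (size q <= d)%N.
  apply/leq_sizeP => j; rewrite leq_eqVlt => /predU1P[<-|dj]; rewrite qE.
    by rewrite mulr_natl subrr.
  by rewrite nth_default ?szp // mul0rn mulr0 subrr.
have q0 : q = 0.
  apply/eqP/negPn/negP => /dvdp_leq /(_ dvd2); rewrite szp => h.
  by have := leq_trans h szq; rewrite ltnn.
have pX : p = 'X^d.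
  apply/polyP => i; rewrite coefXn; case: (ltngtP i d) => [id_|di|->].
  - have := qE i; rewrite q0 coef0 => /esym/eqP; rewrite subr_eq0 => /eqP pid.
    have /eqP : p`_i *+ (d - i) = 0.
      by rewrite mulrnBr 1?ltnW // pid mulr_natl subrr.
    rewrite -[p`_i *+ _]mulr_natr mulf_eq0 (negPf (hF _ _)) ?orbF; first by move/eqP->.
    by rewrite subn_gt0 id_ (leq_trans (leq_subr _ _)).
  - by rewrite nth_default ?szp.
  - by have /monicP := pmon; rewrite /lead_coef szp.
have Ad : A ^+ d = 0 by move: hp0; rewrite pX rmorphXn /= horner_mx_X.
by have := exprD A (n.+1 - d) d; rewrite subnK // => ->; rewrite Ad mulr0.
Qed.

(** * Highest-weight vectors *)

Definition small_units (F : fieldType) (m : nat) : Prop :=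
  forall i, (0 < i <= m)%N -> i%:R != 0 :> F.

Lemma lie_tripleHX (F : fieldType) (n : nat) (Y H X : 'M[F]_n) :
  lie_triple Y H X -> H *m X = X *m H + 2%:R *: X.
Proof. by case=> e _ _; rewrite scaler_nat -e /lie_br addrC subrK. Qed.

Lemma lie_tripleHY (F : fieldType) (n : nat) (Y H X : 'M[F]_n) :
  lie_triple Y H X -> H *m Y = Y *m H - 2%:R *: Y.
Proof. by case=> _ e _; rewrite scaler_nat -e /lie_br addrC subrK. Qed.

Lemma lie_tripleXY (F : fieldType) (n : nat) (Y H X : 'M[F]_n) :
  lie_triple Y H X -> X *m Y = Y *m X + H.
Proof. by case=> _ _ <-; rewrite /lie_br addrC subrK. Qed.

(** This symmetry turns every statement on ker Y and weights into one on ker X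
    and opposite weights. *)
Lemma lie_triple_swap (F : fieldType) (n : nat) (Y H X : 'M[F]_n) :
  lie_triple Y H X -> lie_triple X (- H) Y.
Proof.
rewrite /lie_triple /lie_br => -[e1 e2 e3]; split.
- by rewrite mulNmx mulmxN -opprD e2 opprK.
- by rewrite mulNmx mulmxN -opprD e1.
- by rewrite -e3 opprB.
Qed.

Lemma lie_triple_nilX (F : fieldType) (n : nat) (Y H X : 'M[F]_n.+1) :
  small_units F (n.+1).*2 -> lie_triple Y H X -> X ^+ n.+1 = 0.
Proof.
move=> hF T; apply: (@weight_nilpotent _ _ X H 2%:R).
- by move=> m /andP[m0 mn]; apply: hF; rewrite m0 (leq_trans mn) // -addnn leq_addr.
- by apply: hF; rewrite /= doubleS.
- exact: lie_tripleHX T.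
Qed.

(** The possible weights of the generator of a chain of length at most m are
    0, ..., m - 1. *)
Definition weight_poly (F : fieldType) (m : nat) : {poly F} :=
  \prod_(i < m) ('X - i%:R%:P).

Lemma horner_weight_polyS (F : fieldType) (n m : nat) (H : 'M[F]_n.+1) :
  horner_mx H (weight_poly F m.+1) =
  (H - m%:R%:M) *m horner_mx H (weight_poly F m).
Proof.
by rewrite /weight_poly big_ord_recr /= mulrC rmorphM rmorphB /= horner_mx_X horner_mx_C.
Qed.

Lemma kerY_shift_stable (F : fieldType) (n : nat) (Y H X : 'M[F]_n) (c : F) (u : 'rV_n) :
  lie_triple Y H X -> u *m Y = 0 -> u *m (H - c%:M) *m Y = 0.
Proof.
move=> T uY; rewrite -mulmxA mulmxBl (lie_tripleHY T) mul_scalar_mx !mulmxBr.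
by rewrite -!scalemxAr !mulmxA uY mul0mx !scaler0 !subr0.
Qed.

Lemma weight_expX (F : fieldType) (n : nat) (Y H X : 'M[F]_n.+1) (u : 'rV_n.+1) m :
  lie_triple Y H X ->
  u *m X ^+ m *m H = u *m (H - (2 * m)%:R%:M) *m X ^+ m.
Proof.
move=> T; rewrite -!mulmxA mulmxBl; congr (u *m _).
rewrite [H *m _](commutator_exp m (lie_tripleHX T)) mul_scalar_mx.
by rewrite natrM mulr_natr addrK.
Qed.

Lemma kerY_expXY (F : fieldType) (n : nat) (Y H X : 'M[F]_n.+1) (u : 'rV_n.+1) m :
  lie_triple Y H X -> u *m Y = 0 ->
  u *m X ^+ m.+1 *m Y = m.+1%:R *: (u *m (H - m%:R%:M) *m X ^+ m).
Proof.
move=> T uY; elim: m => [|m IHm].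
  rewrite expr1 expr0 scale1r [_ *m 1]mulmx1 -mulmxA (lie_tripleXY T) mulmxDr.
  by rewrite mulmxA uY mul0mx add0r raddf0 subr0.
rewrite exprSr mulmxA -[in LHS]mulmxA (lie_tripleXY T) mulmxDr (weight_expX _ _ T).
rewrite mulmxA IHm -scalemxAl -mulmxA -[X ^+ m *m X]exprSr scalemxAl -mulmxDl.
rewrite -?[m.+1%:R *: u *m _]scalemxAl [m.+2%:R *: _]scalemxAl; congr (_ *m _).
rewrite !mulmxBr !mul_mx_scalar !scalerBr !scalerA -{2}[u *m H]scale1r.
rewrite addrACA -scalerDl -opprD -scalerDl; congr (_ *: _ - _ *: _).
  by rewrite natr1.
by rewrite -!natrM -natrD; congr _%:R; lia.
Qed.

(** Pushing Y through a power of X produces the weights; doing it m times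
    exhibits a polynomial in H. When X^m vanishes, so does the left-hand side,
    and the polynomial constrains the weights of ker Y. *)
Lemma kerY_expXYn (F : fieldType) (n : nat) (Y H X : 'M[F]_n.+1) (u : 'rV_n.+1) m :
  lie_triple Y H X -> u *m Y = 0 ->
  u *m X ^+ m *m Y ^+ m = m`!%:R *: (u *m horner_mx H (weight_poly F m)).
Proof.
move=> T; elim: m u => [|m IHm] u uY.
  have m1 w : w *m (1 : 'M[F]_n.+1) = w := mulmx1 w.
  by rewrite fact0 scale1r /weight_poly big_ord0 rmorph1 !expr0 !m1.
rewrite [Y ^+ _]exprS mulmxA (kerY_expXY _ T uY) -scalemxAl IHm;
  last exact: kerY_shift_stable T uY.
by rewrite horner_weight_polyS mulmxA scalerA -natrM factS.
Qed.

Lemma kerY_weights (F : fieldType) (n : nat) (Y H X : 'M[F]_n.+1) (u : 'rV_n.+1) :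
  small_units F (n.+1).*2 -> lie_triple Y H X -> u *m Y = 0 ->
  u *m horner_mx H (weight_poly F n.+1) = 0.
Proof.
move=> hF T uY; have := kerY_expXYn n.+1 T uY.
rewrite (lie_triple_nilX hF T) mulmx0 mul0mx => /esym/eqP; rewrite scaler_eq0 => /orP[|/eqP//].
suff /negPf-> : n.+1`!%:R != 0 :> F by [].
have : (n.+1 <= n.+1)%N by [].
elim: {1 3}n.+1 => [|m IHm] mn; first by rewrite oner_neq0.
rewrite factS natrM mulf_neq0 ?IHm 1?ltnW // hF //.
by rewrite (leq_trans mn) // -addnn leq_addr.
Qed.

(** Y raises weights. If w Y^j X is computed from w X Y = 0, it is a nonzero
    multiple of w Y^(j-1) as long as the weight of w is positive; so no w Y^j
    could vanish unless w = 0, whereas Y is nilpotent. *)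
Lemma positive_weight_kerXY (F : fieldType) (n : nat) (Y H X : 'M[F]_n.+1) (w : 'rV_n.+1) (t :
  nat) :
  small_units F (n.+1).*2 -> lie_triple Y H X ->
  (0 < t <= n.+2)%N -> w *m H = t%:R *: w -> w *m X *m Y = 0 -> w = 0.
Proof.
move=> hF T /andP[t0 tn] wH wXY; have T' := lie_triple_swap T.
have wt j : w *m Y ^+ j *m H = (t + 2 * j)%:R *: (w *m Y ^+ j).
  have /eqP := weight_expX w j T'.
  rewrite mulmxN mulmxBr mul_mx_scalar mulmxN wH eqr_oppLR -scaleNr -scalerBl -scalemxAl =>
    /eqP->.
  by rewrite -scaleNr opprB opprK natrD addrC.
have wYX j : w *m Y ^+ j.+1 *m X = - (j.+1 * (t + j))%:R *: (w *m Y ^+ j).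
  have YX : Y *m X = X *m Y - H by rewrite (lie_tripleXY T) addrK.
  elim: j => [|j IHj].
    by rewrite expr1 expr0 [_ *m 1]mulmx1 mul1n addn0 -mulmxA YX mulmxBr mulmxA wXY wH sub0r
      scaleNr.
  rewrite exprSr mulmxA -mulmxA YX mulmxBr mulmxA IHj wt -scalemxAl -mulmxA -[_ *m Y]exprSr
    -scalerBl.
  by rewrite -opprD -natrD; congr (- _%:R *: _); lia.
(* Descend from the vanishing power Y^(n+1) to Y^0. *)
have wY0 : w *m Y ^+ n.+1 = 0 by rewrite (lie_triple_nilX hF T') mulmx0.
suff : forall j, (j <= n.+1)%N -> w *m Y ^+ (n.+1 - j) = 0.
  by move=> /(_ n.+1 (leqnn _)); rewrite subnn expr0 => <-; rewrite [_ *m 1]mulmx1.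
elim=> [|j IHj] jn; first by rewrite subn0.
have := wYX (n.+1 - j.+1)%N; rewrite -subSn // subSS IHj 1?ltnW // mul0mx => /esym/eqP.
rewrite scaler_eq0 oppr_eq0 natrM mulf_eq0.
by rewrite (negPf (hF _ _)) 1?(negPf (hF _ _)) => [/eqP //||]; lia.
Qed.

(** A highest-weight vector w X of weight i comes, up to a vector of ker X, from
    a vector of weight i + 2 > 0. As the weights of ker X are 0, -1, ..., -n, the
    polynomial Q in H that annihilates ker X performs the correction: w Q has
    weight exactly i + 2 and w Q X is a nonzero multiple of w X. *)
Lemma kerY_imX_weight (F : fieldType) (n : nat) (Y H X : 'M[F]_n.+1) (w : 'rV_n.+1) (i : nat) :
  small_units F (n.+1).*2 -> lie_triple Y H X -> (i <= n)%N ->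
  w *m X *m H = i%:R *: (w *m X) -> w *m X *m Y = 0 -> w *m X = 0.
Proof.
move=> hF T iN wXH wXY.
have T' := lie_triple_swap T.
pose Q m := horner_mx (- H) (weight_poly F m).
pose t := i.+2.
have HXE : H *m X = X *m H + 2%:R *: X := lie_tripleHX T.
have QX m : exists2 c : F, (m <= n.+1)%N -> c != 0 &
    forall u : 'rV_n.+1, u *m X *m H = i%:R *: (u *m X) -> u *m Q m *m X = c *: (u *m X).
  elim: m => [|m [c c0 IHm]].
    by exists 1 => [_|u _]; rewrite ?oner_neq0 // /Q /weight_poly big_ord0 rmorph1 [u *m
      1]mulmx1 scale1r.
  exists (c * - (m + t)%:R).
    by move=> mn; rewrite mulf_neq0 ?c0 1?ltnW // oppr_eq0 hF //; lia.
  move=> u uXH.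
  have uX : u *m (- H - m%:R%:M) *m X = - (m + t)%:R *: (u *m X).
    rewrite -mulmxA mulmxBl mulNmx HXE mul_scalar_mx -opprD mulmxN !mulmxDr -!scalemxAr mulmxA
      uXH.
    rewrite -!scalerDl scaleNr; congr (- (_ *: _)).
    by rewrite /t -!natrD; congr _%:R; lia.
  rewrite /Q horner_weight_polyS mulmxA -/(Q m) IHm.
    by rewrite uX scalerA.
  by rewrite uX -scalemxAl uXH !scalerA mulrC.
have [c c0 Qw] := QX n.+1.
have wQX := Qw _ wXH; set w1 := w *m Q n.+1 in wQX.
have w1H : w1 *m H = t%:R *: w1.
  have : w *m (H - t%:R%:M) *m Q n.+1 = 0.
    apply: (kerY_weights hF T').
    rewrite -mulmxA mulmxBl HXE mul_scalar_mx -addrA -scalerBl mulmxDr mulmxA wXH -scalemxAr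
      -scalerDl.
    have -> : i%:R + (2%:R - t%:R) = 0 :> F.
      by rewrite addrA -natrD /t addn2 subrr.
    by rewrite scale0r.
  have QH : Q n.+1 *m H = H *m Q n.+1.
    rewrite /Q; have := rmorphM (horner_mx (- H)) 'X (weight_poly F n.+1).
    by rewrite mulrC rmorphM /= horner_mx_X mulrN mulNr => /oppr_inj.
  rewrite -mulmxA mulmxBl mul_scalar_mx mulmxBr -QH mulmxA -/w1 -scalemxAr -/w1.
  by move/eqP; rewrite subr_eq0 => /eqP.
have w1XY : w1 *m X *m Y = 0 by rewrite wQX -scalemxAl wXY scaler0.
have w10 : w1 = 0 by apply: (positive_weight_kerXY hF T _ w1H w1XY); rewrite /t; lia.
move: wQX; rewrite w10 mul0mx => /esym/eqP; rewrite scaler_eq0 (negPf (c0 (leqnn _))).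
by move/eqP.
Qed.

(** The intersection of ker Y and im X is stable under H, and the factors of
    [weight_poly] annihilate it; they can be removed one by one because the
    intersection contains no eigenvector with one of these eigenvalues. *)
Lemma kerY_imX_disjoint (F : fieldType) (n : nat) (Y H X : 'M[F]_n.+1) (w : 'rV_n.+1) :
  small_units F (n.+1).*2 -> lie_triple Y H X -> w *m X *m Y = 0 -> w *m X = 0.
Proof.
move=> hF T wXY.
suff main m : (m <= n.+1)%N -> forall w : 'rV_n.+1, w *m X *m Y = 0 ->
    w *m X *m horner_mx H (weight_poly F m) = 0 -> w *m X = 0.
  exact: (main n.+1 (leqnn _) _ wXY (kerY_weights hF T wXY)).
elim: m => [|m IHm] mn {wXY}w wXY.
  by rewrite /weight_poly big_ord0 rmorph1 [_ *m 1]mulmx1.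
rewrite horner_weight_polyS mulmxA => h.
have e : w *m X *m (H - m%:R%:M) = w *m (H - (m.+2)%:R%:M) *m X.
  rewrite -!mulmxA mulmxBl mulmxBr (lie_tripleHX T) mul_mx_scalar mul_scalar_mx.
  rewrite -addrA -scalerBl (_ : 2%:R - m.+2%:R = - m%:R) ?scaleNr //.
  by rewrite -(addn2 m) natrD opprD addrCA subrr addr0.
have h0 : w *m X *m (H - m%:R%:M) = 0.
  rewrite e; apply: (IHm (ltnW mn)); rewrite -e //.
  exact: kerY_shift_stable T wXY.
apply: (kerY_imX_weight (i := m) hF T _ _ wXY) => //.
by move: h0; rewrite mulmxBr mul_mx_scalar => /eqP; rewrite subr_eq0 => /eqP.
Qed.

Lemma kerY_imX_cap (F : fieldType) (n : nat) (Y H X : 'M[F]_n.+1) :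
  small_units F (n.+1).*2 -> lie_triple Y H X -> (kermx Y :&: X)%MS = 0.
Proof.
move=> hF T; apply/eqP/rowV0P => v; rewrite sub_capmx => /andP[/sub_kermxP vY /submxP[w vE]].
by rewrite vE; apply: (kerY_imX_disjoint hF T); rewrite -vE.
Qed.

Lemma lie_triple_rank_le (F : fieldType) (n : nat) (Y H X : 'M[F]_n.+1) :
  small_units F (n.+1).*2 -> lie_triple Y H X -> (\rank X <= \rank Y)%N.
Proof.
move=> hF T; have := mxrank_sum_cap (kermx Y) X.
rewrite (kerY_imX_cap hF T) mxrank0 addn0 mxrank_ker.
have := rank_leq_col (kermx Y + X)%MS; have := rank_leq_col Y; lia.
Qed.

Lemma lie_triple_rank (F : fieldType) (n : nat) (Y H X : 'M[F]_n.+1) :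
  small_units F (n.+1).*2 -> lie_triple Y H X -> \rank X = \rank Y.
Proof.
move=> hF T; apply/eqP; rewrite eqn_leq (lie_triple_rank_le hF T).
exact: (lie_triple_rank_le hF (lie_triple_swap T)).
Qed.

Lemma kerY_imX_full (F : fieldType) (n : nat) (Y H X : 'M[F]_n.+1) :
  small_units F (n.+1).*2 -> lie_triple Y H X -> row_full (kermx Y + X)%MS.
Proof.
move=> hF T; have := mxrank_sum_cap (kermx Y) X.
rewrite (kerY_imX_cap hF T) mxrank0 addn0 mxrank_ker (lie_triple_rank hF T) /row_full => ->.
by apply/eqP; rewrite subnK // rank_leq_col.
Qed.

(** Iterating k^n = ker Y + k^n X. *)
Lemma kerY_X_span (F : fieldType) (n : nat) (Y H X : 'M[F]_n.+1) (w : 'rV_n.+1) m :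
  small_units F (n.+1).*2 -> lie_triple Y H X ->
  exists u : nat -> 'rV[F]_n.+1, exists w',
    (forall j, u j *m Y = 0) /\ w = \sum_(j < m) u j *m X ^+ j + w' *m X ^+ m.
Proof.
move=> hF T; elim: m => [|m [u [w' [uY ->]]]].
  by exists (fun=> 0), w; split=> [j|]; rewrite ?mul0mx // big_ord0 add0r expr0 [_ *m 1]mulmx1.
have /sub_addsmxP [[a b] /= w'E] : (w' <= kermx Y + X)%MS by exact/submx_full/kerY_imX_full/T.
exists (fun j => if (j < m)%N then u j else a *m kermx Y), b; split=> [j|].
  by case: ifP => // _; rewrite -mulmxA mulmx_ker mulmx0.
rewrite big_ord_recr /= ltnn w'E mulmxDl addrA exprS mulmxA; congr (_ + _ + _).
  by apply: eq_bigr => j _; rewrite ltn_ord.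
by rewrite -mulmxA.
Qed.

(** * Chain bases *)

(** The distinct roots 0, ..., n of the annihilating polynomial make the
    restriction of H to the row space of K diagonalizable. *)
Lemma weight_eigenbasis (F : fieldType) (n r : nat) (H : 'M[F]_n.+1) (K : 'M[F]_(r, n.+1)) :
  small_units F n -> row_free K -> stablemx K H ->
  K *m horner_mx H (weight_poly F n.+1) = 0 ->
  exists P : 'M[F]_r, exists mu : 'I_r -> nat,
    [/\ P \in unitmx, forall a, (mu a <= n)%N &
        forall a, row a (P *m K) *m H = (mu a)%:R *: row a (P *m K)].
Proof.
move=> hF fK sK pK; case: r => [|r] in K fK sK pK *.
  by exists 1%:M, (fun=> 0%N); split=> [||[]] //; rewrite unitmx1.
pose A := conjmx K H.
have AK : A *m K = K *m H by rewrite /A /conjmx mulmxKpV.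
pose rs : seq F := [seq i%:R | i <- iota 0 n.+1].
have urs : uniq rs.
  rewrite map_inj_in_uniq ?iota_uniq // => i j; rewrite !mem_iota /= !add0n => iN jN.
  wlog ij : i j iN jN / (i <= j)%N.
    by move=> W e; case/orP: (leq_total i j) => h; [|symmetry]; apply: W.
  move/eqP; rewrite eq_sym -subr_eq0 -natrB // => /eqP e.
  apply/eqP; rewrite eqn_leq ij leqNgt -subn_gt0; apply/negP => ji.
  have /hF : (0 < j - i <= n)%N by rewrite ji /= (leq_trans (leq_subr _ _)).
  by rewrite e eqxx.
have dA : diagonalizable A.
  apply/diagonalizableP; exists rs => //; apply: mxminpoly_min.
  have io : iota 0 n.+1 = index_iota 0 n.+1 by rewrite /index_iota subn0.
  rewrite big_map io big_mkord.
  by rewrite horner_mx_conj // /conjmx pK mul0mx.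
have [P Pu /(diagonalizable_forP _ Pu) dP] := dA.
have [D [dD PAE]] : exists D : 'M[F]_r.+1,
    (forall i j, i != j -> D i j = 0) /\ P *m A = D *m P.
  by exists (P *m A *m invmx P); split=> [i j /dP//|]; rewrite mulmxKV.
have Drow a : row a (P *m K) *m H = D a a *: row a (P *m K).
  rewrite -row_mul -mulmxA -AK mulmxA PAE -mulmxA row_mul.
  rewrite (_ : row a D = D a a *: delta_mx 0 a) -?scalemxAl -?rowE //.
  by apply/rowP => j; rewrite !mxE eqxx /=; case: eqP => [->|/eqP h];
    rewrite ?mulr1 // mulr0 dD // eq_sym.
have ev a : {i : nat | (i <= n)%N & D a a = i%:R}.
  apply: cid2.
  pose w := row a (P *m K).
  have wH p : w *m horner_mx H p = p.[D a a] *: w.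
    elim/poly_ind: p => [|p c IH]; first by rewrite rmorph0 horner0 mulmx0 scale0r.
    rewrite rmorphD rmorphM /= horner_mx_X horner_mx_C mulmxDr mul_mx_scalar mulmxA IH.
    by rewrite -scalemxAl Drow scalerA -scalerDl hornerMXaddC.
  have w0 : w != 0.
    rewrite /w rowE; apply/eqP => /(congr1 (mulmx^~ (pinvmx K)));
      rewrite mul0mx mulmxA mulmxKp //.
    move=> /(congr1 (mulmx^~ (invmx P))); rewrite mul0mx mulmxK // => /matrixP /(_ 0 a).
    by rewrite !mxE !eqxx => /eqP; rewrite oner_eq0.
  have : w *m horner_mx H (weight_poly F n.+1) = 0 by rewrite /w row_mul -mulmxA pK mulmx0.
  rewrite wH => /eqP; rewrite scaler_eq0 (negPf w0) orbF /weight_poly horner_prod.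
  move=> /eqP/eqP/prodf_eq0 [i _]; rewrite hornerXsubC subr_eq0 => /eqP e.
  by exists i => //; rewrite -ltnS.
exists P, (fun a => s2val (ev a)); split=> // a; case: (ev a) => //= i _ <-.
exact: Drow.
Qed.

Lemma kerY_eigenbasis (F : fieldType) (n : nat) (Y H X : 'M[F]_n.+1) :
  small_units F (n.+1).*2 -> lie_triple Y H X ->
  exists U : 'M[F]_(\rank (kermx Y), n.+1), exists mu : 'I_(\rank (kermx Y)) -> nat,
    [/\ row_free U, (U :=: kermx Y)%MS, forall a, (mu a <= n)%N &
        forall a, row a U *m H = (mu a)%:R *: row a U].
Proof.
move=> hF T; pose K := row_base (kermx Y).
have KY : K *m Y = 0 by apply/sub_kermxP; rewrite eq_row_base.
have kK (w : 'rV_n.+1) : (w <= K)%MS = (w *m Y == 0) by rewrite eq_row_base;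
  apply/sub_kermxP/eqP.
have [||||P [mu [Pu mun muE]]] := @weight_eigenbasis F n _ H K.
- by move=> i /andP[i0 iN]; apply: hF; lia.
- exact: row_base_free.
- apply/row_subP => i; rewrite row_mul kK.
  have iY : row i K *m Y = 0 by rewrite -row_mul KY row0.
  by have := kerY_shift_stable 0 T iY; rewrite raddf0 subr0 => ->.
- apply/row_matrixP => i; rewrite row_mul row0; apply: (kerY_weights hF T).
  by rewrite -row_mul KY row0.
exists (P *m K), mu; split=> //.
- by rewrite /row_free mxrankMfree ?row_base_free // mxrank_unit.
- apply: eqmx_trans (eq_row_base _); by apply: eqmxMfull; rewrite row_full_unit.
Qed.

Definition chain_vec (F : fieldType) (n r : nat) (U : 'M[F]_(r, n.+1)) (X : 'M[F]_n.+1)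
  (a : 'I_r) (j : nat) : 'rV[F]_n.+1 := row a U *m X ^+ j.

Lemma chain_vecX (F : fieldType) (n r : nat) (U : 'M[F]_(r, n.+1)) (X : 'M[F]_n.+1) a j :
  chain_vec U X a j *m X = chain_vec U X a j.+1.
Proof. by rewrite /chain_vec -mulmxA exprSr. Qed.

(** A chain stops right after its expected length mu + 1: the next vector would
    be both in ker Y and in im X. *)
Lemma chain_vecY (F : fieldType) (n r : nat) (Y H X : 'M[F]_n.+1) (U : 'M[F]_(r, n.+1))
    (mu : 'I_r -> nat) (a : 'I_r) :
  small_units F (n.+1).*2 -> lie_triple Y H X -> U *m Y = 0 ->
  row a U *m H = (mu a)%:R *: row a U ->
  (forall j, (mu a < j)%N -> chain_vec U X a j = 0) /\
  (forall j, chain_vec U X a j *m Y = (j * (mu a - j.-1))%:R *: chain_vec U X a j.-1).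
Proof.
move=> hF T UY uH; pose v j := chain_vec U X a j; rewrite -/v.
have uY : row a U *m Y = 0 by rewrite -row_mul UY row0.
have vY j : (j <= mu a)%N -> v j.+1 *m Y = (j.+1 * (mu a - j))%:R *: v j.
  move=> jm; rewrite /v /chain_vec (kerY_expXY _ T uY) mulmxBr uH mul_mx_scalar.
  by rewrite -scalerBl -scalemxAl scalerA natrM natrB.
have v0 j : (mu a < j)%N -> v j = 0.
  elim: j => // j IHj; rewrite ltnS leq_eqVlt => /predU1P[<-|/IHj vj]; last first.
    by rewrite /v -chain_vecX -/(v j) vj mul0mx.
  rewrite /v -chain_vecX; apply: (kerY_imX_disjoint hF T).
  by rewrite chain_vecX vY // subnn muln0 scale0r.
split=> // -[|j]; first by rewrite mul0n scale0r /v /chain_vec expr0 [_ *m 1]mulmx1.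
case: (leqP j (mu a)) => [/vY //|jm].
have := v0 j.+1 (leqW jm); rewrite /v => ->.
by have := v0 j jm; rewrite /v /= => ->; rewrite mul0mx scaler0.
Qed.

(** Applying Y to the j-th vector of a chain j times gives back its generator;
    this separates the positions when independence is tested. *)
Lemma chain_vecYn (F : fieldType) (n r : nat) (Y X : 'M[F]_n.+1) (U : 'M[F]_(r, n.+1))
    (mu : 'I_r -> nat) (a : 'I_r) :
  small_units F (n.+1).*2 -> (mu a <= n)%N ->
  (forall j, chain_vec U X a j *m Y = (j * (mu a - j.-1))%:R *: chain_vec U X a j.-1) ->
  forall j, (j <= mu a)%N ->
    [/\ exists2 c : F, c != 0 & chain_vec U X a j *m Y ^+ j = c *: row a U &
        forall k, (j < k)%N -> chain_vec U X a j *m Y ^+ k = 0].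
Proof.
move=> hF mun vY.
have v0Y k : (0 < k)%N -> chain_vec U X a 0 *m Y ^+ k = 0.
  by case: k => // k _; rewrite exprS mulmxA vY mul0n scale0r mul0mx.
elim=> [|j IHj] jm.
  split=> //; exists 1; first exact: oner_neq0.
  have m1 (w : 'rV_n.+1) : w *m (1 : 'M[F]_n.+1) = w := mulmx1 w.
  by rewrite scale1r /chain_vec !expr0 !m1.
have [[c c0 cE] IH0] := IHj (ltnW jm).
split=> [|[//|k] jk]; last by rewrite exprS mulmxA vY -scalemxAl IH0 ?scaler0.
exists ((j.+1 * (mu a - j))%:R * c); last by rewrite exprS mulmxA vY -scalemxAl cE scalerA.
by rewrite natrM !mulf_neq0 ?hF //; lia.
Qed.

(** The vectors u X^j, for u in a basis of weight vectors of ker Y and j up to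
    the weight of u, span k^n by iterating k^n = ker Y + k^n X. In a linear
    relation, applying Y^J for the largest occurring position J leaves a
    relation between the generators u, which are independent. *)
Lemma chain_basis (F : fieldType) (n : nat) (Y H X : 'M[F]_n.+1) :
  small_units F (n.+1).*2 -> lie_triple Y H X ->
  exists P : 'M[F]_n.+1, exists blk : 'I_n.+1 -> 'I_(n.+1 - \rank X),
  exists pos : 'I_n.+1 -> nat, exists cy : 'I_n.+1 -> nat,
  [/\ P \in unitmx,
      forall a, exists i, blk i = a,
      P *m X = (\matrix_(i, j) ((blk j == blk i) && (pos j == (pos i).+1))%:R) *m P,
      P *m Y = (\matrix_(i, j) (((blk j == blk i) && ((pos j).+1 == pos i)) * cy i)%:R) *m P &
      forall i, row i P *m X = 0 \/ exists2 ab, (0 < ab.1 <= n)%N && (0 < ab.2 <= n)%N &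
          row i P *m X *m Y = (ab.1 * ab.2)%:R *: row i P].
Proof.
move=> hF T; have [U [mu [fU UE mun muE]]] := kerY_eigenbasis hF T.
move: U mu fU UE mun muE; rewrite mxrank_ker -(lie_triple_rank hF T).
set r := (n.+1 - \rank X)%N => U mu fU UE mun muE.
have UY : U *m Y = 0 by apply/sub_kermxP; rewrite UE.
pose v := chain_vec U X.
have v0 a : forall j, (mu a < j)%N -> v a j = 0 by have [] := chain_vecY hF T UY (muE a).
have vY a : forall j, v a j *m Y = (j * (mu a - j.-1))%:R *: v a j.-1.
  by have [] := chain_vecY hF T UY (muE a).
have vX a j : v a j *m X = v a j.+1 by exact: chain_vecX.
have vYn a := chain_vecYn hF (mun a) (vY a).
pose S := [set aj : 'I_r * 'I_n.+1 | (aj.2 <= mu aj.1)%N]%SET.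
pose e (i : 'I_#|S|) : 'I_r * 'I_n.+1 := enum_val i.
have eS i : ((e i).2 <= mu (e i).1)%N by have := enum_valP i; rewrite inE.
have einj : injective e by exact: enum_val_inj.
have esurj a j : (j <= mu a)%N -> exists2 i, (e i).1 = a & (e i).2 = j :> nat.
  move=> jm; have jn : (j < n.+1)%N by rewrite ltnS (leq_trans jm).
  have aS : (a, Ordinal jn) \in S by rewrite inE.
  by exists (enum_rank_in aS (a, Ordinal jn)); rewrite /e enum_rankK_in.
pose B := \matrix_(i < #|S|) v (e i).1 (e i).2.
have rB i : row i B = v (e i).1 (e i).2 by rewrite rowK.
have vB a j : (v a j <= B)%MS.
  case: (leqP j (mu a)) => [/esurj[i <- <-]|/v0->]; last exact: sub0mx.
  by rewrite -rB row_sub.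
have fullB : row_full B.
  rewrite -sub1mx; apply/row_subP => i; set w := row i _.
  have [u [w' [uY ->]]] := kerY_X_span w n.+1 hF T.
  rewrite (lie_triple_nilX hF T) mulmx0 addr0 summx_sub // => j _.
  have /submxP[t ->] : (u j <= U)%MS by rewrite UE; apply/sub_kermxP.
  rewrite -mulmxA mulmx_sum_row summx_sub // => a _.
  by rewrite row_mul scalemx_sub //; exact: vB.
have freeB : row_free B.
  apply: inj_row_free => w wB; apply/eqP/negPn/negP => /rV0Pn[i1 wi1].
  have [i0 wi0 imax] : exists2 i0, w 0 i0 != 0 &
      forall i, w 0 i != 0 -> ((e i).2 <= (e i0).2)%N.
    pose i0 := [arg max_(i > i1 | w 0%R i != 0%R) (e i).2 : nat]%N.
    by exists i0; rewrite /i0; case: arg_maxnP.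
  set J := nat_of_ord (e i0).2 in imax.
  have /fin_all_exists[c cP] (i : 'I_#|S|) : exists c : F,
      [/\ w 0 i *: (v (e i).1 (e i).2 *m Y ^+ J) = c *: row (e i).1 U,
          (e i).2 != J :> nat -> c = 0 & i = i0 -> c != 0].
    have [wi|wi] := eqVneq (w 0 i) 0.
      by exists 0; rewrite wi !scale0r; split=> // ii0; move: wi0; rewrite -ii0 wi eqxx.
    have := imax i wi; rewrite leq_eqVlt => /predU1P[eJ|ltJ]; last first.
      exists 0; have [_ ->] := vYn _ _ (eS i); rewrite // scaler0 scale0r; split=> //.
      by move=> ii0; move: ltJ; rewrite ii0 ltnn.
    have [[d d0 dE] _] := vYn _ _ (eS i).
    exists (w 0 i * d); split=> [|/eqP//|_]; last by rewrite mulf_neq0.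
    by rewrite /v -eJ dE scalerA.
  have := congr1 (mulmx^~ (Y ^+ J)) wB; rewrite mul0mx (mulmx_sum_row w) mulmx_suml.
  have -> : \sum_i (w 0 i *: row i B *m Y ^+ J) = (\sum_i c i *: delta_mx 0 (e i).1) *m U.
    rewrite mulmx_suml; apply: eq_bigr => i _; rewrite rB -scalemxAl.
    by have [-> _ _] := cP i; rewrite -scalemxAl -rowE.
  move=> /eqP; rewrite mulmx_free_eq0 // => /eqP/matrixP/(_ 0 (e i0).1).
  rewrite summxE (bigD1 i0) //= big1 => [|i ii0].
    rewrite !mxE !eqxx mulr1 addr0 => c0.
    by have [_ _ /(_ erefl)] := cP i0; rewrite c0 eqxx.
  rewrite !mxE eqxx /=; case: eqP => [e1|]; last by rewrite mulr0.
  suff -> : c i = 0 by rewrite mul0r.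
  have [_ + _] := cP i; apply.
  apply: contraNN ii0 => /eqP e2; apply/eqP/einj.
  by rewrite (surjective_pairing (e i)) (surjective_pairing (e i0)) e1; congr pair;
    exact/val_inj.
(* A spanning and free family has n + 1 elements, so it can be indexed by 'I_n.+1. *)
have mN : n.+1 = #|S| := etrans (esym (eqP fullB)) (eqP freeB).
pose f i := e (cast_ord mN i).
pose P := \matrix_(i < n.+1) v (f i).1 (f i).2.
have rP i : row i P = v (f i).1 (f i).2 by rewrite rowK.
have finj : injective f by move=> i j /einj/cast_ord_inj.
have fsurj a j : (j <= mu a)%N -> exists2 i, (f i).1 = a & (f i).2 = j :> nat.
  by move=> /esurj[i ia ij]; exists (cast_ord (esym mN) i); rewrite /f cast_ordKV.
have fS i : ((f i).2 <= mu (f i).1)%N by exact: eS.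
have sumP (b : F) a k :
    \sum_j (b *+ (((f j).1 == a) && ((f j).2 == k :> nat))) *: row j P = b *: v a k.
  case: (leqP k (mu a)) => [/fsurj[i ia ik]|km]; last first.
    rewrite v0 // scaler0 big1 // => j _.
    case: andP => [[/eqP ja /eqP jk]|_]; last by rewrite mulr0n scale0r.
    by have := fS j; rewrite ja jk leqNgt km.
  rewrite (bigD1 i) //= ia ik !eqxx mulr1n rP ia ik big1 ?addr0 // => j ji.
  case: andP => [[/eqP ja /eqP jk]|_]; last by rewrite mulr0n scale0r.
  case/eqP: ji; apply: finj; rewrite (surjective_pairing (f i)) (surjective_pairing (f j)).
  by rewrite ja ia; congr pair; apply: val_inj; rewrite /= jk ik.
exists P, (fun i => (f i).1), (fun i => (f i).2 : nat).
exists (fun i => ((f i).2 * (mu (f i).1 - (f i).2.-1))%N); split.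
- rewrite -row_full_unit -sub1mx; apply: submx_trans (_ : (B <= P)%MS).
    by rewrite sub1mx.
  apply/row_subP => i; have -> : row i B = row (cast_ord (esym mN) i) P; last exact: row_sub.
  by rewrite rB rP /f cast_ordKV.
- by move=> a; have [i ia _] := fsurj a 0%N isT; exists i.
- apply/row_matrixP => i; rewrite !row_mul rP vX mulmx_sum_row.
  rewrite -[LHS]scale1r -sumP; apply: eq_bigr => j _.
  by rewrite !mxE.
- apply/row_matrixP => i; rewrite !row_mul rP vY mulmx_sum_row.
  case fi: (nat_of_ord (f i).2) => [|k].
    rewrite mul0n scale0r; symmetry; apply: big1 => j _.
    by rewrite !mxE fi /= andbF mul0n scale0r.
  rewrite -sumP; apply: eq_bigr => j _; rewrite !mxE fi eqSS.
  by case: andP => _; rewrite ?mul1n ?mul0n.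
- move=> i; rewrite rP vX; case: (ltnP (f i).2 (mu (f i).1)) => h; last by left; rewrite v0.
  right; exists ((f i).2.+1, (mu (f i).1 - (f i).2)%N); last by rewrite vY.
  by have := mun (f i).1; rewrite /=; lia.
Qed.

(** * An operator with values in the kernel of X *)

(** On a chain, X Y has the eigenvalues a b with 1 <= a, b <= n, and 0 at the
    last vector. Each factor removes one nonzero eigenvalue, so the image is
    spanned by the last vectors of the chains, on which the product is the
    identity. *)
Definition kernel_corrector (F : fieldType) (n : nat) (Y X : 'M[F]_n.+1) : 'M[F]_n.+1 :=
  \prod_(ab : 'I_n * 'I_n) (1 - ((ab.1.+1 * ab.2.+1)%:R)^-1 *: (X *m Y)).

Lemma kernel_correctorX (F : fieldType) (n : nat) (Y H X : 'M[F]_n.+1) :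
  small_units F (n.+1).*2 -> lie_triple Y H X -> kernel_corrector Y X *m X = 0.
Proof.
move=> hF T; have [P [blk [pos [cy [Pu _ _ _ rP]]]]] := chain_basis hF T.
suff: P *m (kernel_corrector Y X *m X) = 0.
  by move/(congr1 (mulmx (invmx P))); rewrite mulKmx // mulmx0.
have scal (w : 'rV[F]_n.+1) d : w *m X *m Y = d *: w ->
    w *m kernel_corrector Y X =
    (\prod_(ab : 'I_n * 'I_n) (1 - ((ab.1.+1 * ab.2.+1)%:R)^-1 * d)) *: w.
  rewrite -mulmxA => wd; rewrite /kernel_corrector; elim/big_rec2: _ => [|ab c A _ IH].
    by rewrite scale1r; exact: mulmx1.
  rewrite mulmxA mulmxBr -scalemxAr wd scalerA [w *m 1]mulmx1 -{1}[w]scale1r -scalerBl.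
  by rewrite -scalemxAl IH scalerA.
apply/row_matrixP => i; rewrite row0 row_mul mulmxA.
case: (rP i) => [iX|[[a b] /= ab_n iXY]].
  by rewrite (scal _ 0) ?iX ?mul0mx ?scale0r // -scalemxAl iX scaler0.
rewrite (scal _ _ iXY).
have [an bn] : (a.-1 < n)%N /\ (b.-1 < n)%N by lia.
have [aE bE] : a.-1.+1 = a /\ b.-1.+1 = b by lia.
rewrite (bigD1 (Ordinal an, Ordinal bn)) //= aE bE mulVf ?subrr ?mul0r ?scale0r ?mul0mx //.
by rewrite natrM mulf_neq0 // hF //; lia.
Qed.

(** * The rank of a Jordan matrix *)

Lemma mem_scanl_lt (lam : seq nat) (s : nat) :
  0%N \notin lam -> forall m, m \in scanl addn s lam -> (s < m <= s + sumn lam)%N.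
Proof.
elim: lam s => //= a lam IH s; rewrite inE negb_or eq_sym -lt0n => /andP[a0 l0] m.
rewrite inE => /predU1P[->|/(IH _ l0)]; lia.
Qed.

Lemma scanl_uniq (lam : seq nat) (s : nat) :
  0%N \notin lam -> uniq (scanl addn s lam).
Proof.
elim: lam s => //= a lam IH s; rewrite inE negb_or => /andP[a0 l0]; rewrite IH // andbT.
by apply/negP => /(mem_scanl_lt l0); rewrite ltnn.
Qed.

Lemma sumn_in_scanl (lam : seq nat) (s : nat) :
  lam != [::] -> (s + sumn lam)%N \in scanl addn s lam.
Proof.
elim: lam s => //= a [|b lam] IH s _; first by rewrite addn0 inE eqxx.
by rewrite inE addnA IH ?orbT.
Qed.

(** The rows of a Jordan matrix are zero or distinct unit vectors, and the zero
    rows are those ending a block; there is one for each part because the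
    partial sums of the parts are distinct. *)
Lemma rank_jordan_mx (F : fieldType) (n : nat) (lam : seq nat) :
  is_partition lam n -> (n - \rank (jordan_mx F n lam))%N = size lam.
Proof.
case=> _ l0 sl; set J := jordan_mx F n lam; set ps := scanl addn 0%N lam.
pose A : {set 'I_n} := [set i : 'I_n | i.+1 \notin ps]%SET.
have ltA i : i \in A -> (i.+1 < n)%N.
  rewrite inE => iA; rewrite ltn_neqAle ltn_ord andbT; apply: contra iA => /eqP ->.
  rewrite -sl -[sumn lam]add0n sumn_in_scanl //.
  by case: (lam) sl => //= n0; case: i; rewrite -n0.
have cA : #|~: A| = size lam.
  have -> : size lam = size ps by rewrite size_scanl.
  rewrite cardE -(size_map (fun i : 'I_n => i.+1)); apply: perm_size; apply: uniq_perm.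
  - by rewrite map_inj_uniq ?enum_uniq // => i j [] /val_inj.
  - exact: scanl_uniq.
  move=> m; apply/mapP/idP => [[i]|mps]; first by rewrite mem_enum !inE negbK => mps ->.
  have /andP[m0 mn] := mem_scanl_lt l0 mps; rewrite add0n sl in mn.
  have mn' : (m.-1 < n)%N by rewrite prednK.
  by exists (Ordinal mn'); rewrite ?mem_enum ?inE /= prednK // negbK.
suff -> : \rank J = #|A|.
  by rewrite -cA -[X in (X - _)%N]card_ord -(cardsC A) addKn.
pose V := rowsub (enum_val : 'I_#|A| -> 'I_n) J.
have VE i j : V i j = (j == (enum_val i).+1 :> nat)%:R.
  have := enum_valP i; rewrite inE => iA.
  by rewrite !mxE; case: eqP => //= ->; rewrite iA.
have <- : \rank V = #|A|.
  apply/eqP; rewrite -/(row_free V); apply/row_freeP; exists (V^T).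
  apply/matrixP => i k; rewrite !mxE (bigD1 (Ordinal (ltA _ (enum_valP i)))) //= big1 => [|j
    jn].
    rewrite [(V^T) _ _]mxE !VE eqxx mul1r addr0 /= eqSS.
    by rewrite (inj_eq val_inj) (inj_eq enum_val_inj) eq_sym.
  rewrite VE; case: eqP => [e|]; last by rewrite mul0r.
  by case/eqP: jn; apply: val_inj.
apply/eqP; rewrite eqn_leq !mxrankS //.
  exact: rowsub_sub.
apply/row_subP => i; case iA : (i \in A).
  rewrite (_ : row i J = row (enum_rank_in iA i) V) ?row_sub //.
  by apply/rowP => j; rewrite !mxE enum_rankK_in.
rewrite (_ : row i J = 0) ?sub0mx //; apply/rowP => j; rewrite !mxE.
by move: iA; rewrite inE => /negbFE h; case: eqP => //= ->; rewrite h.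
Qed.

Lemma orbit_part_rank (k K : fieldType) (iota : {rmorphism k -> K}) (n : nat)
    (lam : seq nat) (A : 'M[k]_n) :
  is_partition lam n -> orbit_part_rat iota n lam A -> (n - \rank A)%N = size lam.
Proof.
move=> lamP [_ [g detg e]]; rewrite -(rank_jordan_mx K lamP) -(mxrank_map iota) -e /Ad.
have gu : g \in unitmx by rewrite unitmxE [\det g]detg unitr1.
rewrite mxrankMfree ?row_free_unit ?unitmx_inv //.
by rewrite -mxrank_tr trmx_mul mxrankMfree ?mxrank_tr // row_free_unit unitmx_tr.
Qed.

(** * Valuations and depth filtrations *)

Lemma lf_val1 (k : local_field) : lf_val (1 : k) = 0.
Proof.
have := lf_valM (oner_neq0 k) (oner_neq0 k); rewrite mulr1 => /eqP.
by rewrite -subr_eq subrr eq_sym => /eqP.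
Qed.

Lemma lf_valN (k : local_field) (a : k) : a != 0 -> lf_val (- a) = lf_val a.
Proof.
have N1 : (-1 : k) != 0 by rewrite oppr_eq0 oner_neq0.
move=> a0; rewrite -mulN1r lf_valM //.
by have := lf_valM N1 N1; rewrite mulrNN mulr1 lf_val1; lia.
Qed.

Lemma lf_valV (k : local_field) (a : k) : a != 0 -> lf_val a^-1 = - lf_val a.
Proof.
move=> a0; have := lf_valM a0 (invr_neq0 a0); rewrite divff // lf_val1; lia.
Qed.

Lemma lf_val_onto (k : local_field) (m : int) : exists2 a : k, a != 0 & lf_val a = m.
Proof.
have [t t0 t1] := lf_val_normalized k.
have vX j : lf_val (t ^+ j) = j%:Z.
  elim: j => [|j IH]; first by rewrite expr0 lf_val1.
  by rewrite exprS lf_valM ?expf_neq0 // IH t1; lia.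
case: m => j; first by exists (t ^+ j); rewrite ?expf_neq0.
by exists (t ^+ j.+1)^-1; rewrite ?invr_neq0 ?expf_neq0 // lf_valV ?expf_neq0 // vX NegzE.
Qed.

Lemma val_geD (R : realType) (k : local_field) (s : R) (a b : k) :
  val_ge s a -> val_ge s b -> val_ge s (a + b).
Proof.
have [->|a0] := eqVneq a 0; first by rewrite add0r.
have [->|b0] := eqVneq b 0; first by rewrite addr0.
move=> [/eqP|sa]; first by rewrite (negPf a0).
move=> [/eqP|sb]; first by rewrite (negPf b0).
have [->|ab0] := eqVneq (a + b) 0; first by left.
right; apply: le_trans (_ : (Num.min (lf_val a) (lf_val b))%:~R <= _).
  by rewrite minEle; case: ifP.
by rewrite ler_int lf_valD.
Qed.

Lemma val_geN (R : realType) (k : local_field) (s : R) (a : k) :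
  val_ge s a -> val_ge s (- a).
Proof.
have [->|a0] := eqVneq a 0; first by rewrite oppr0.
by move=> [/eqP|sa]; [rewrite (negPf a0)|right; rewrite lf_valN].
Qed.

Lemma val_ge_sum (R : realType) (k : local_field) (s : R) (I : Type) (l : seq I)
    (P : pred I) (f : I -> k) :
  (forall i, P i -> val_ge s (f i)) -> val_ge s (\sum_(i <- l | P i) f i).
Proof. by move=> h; elim/big_ind: _ => // [|a b]; [left|exact: val_geD]. Qed.

Lemma val_ge_mulz (R : realType) (k : local_field) (s : R) (a : k) (m : int) :
  val_ge s a -> val_ge s (a *~ m).
Proof.
move=> sa; have n j : val_ge s (a *+ j).
  by elim: j => [|j IH]; [left|rewrite mulrS; exact: val_geD].
by case: m => j; [exact: n|rewrite NegzE mulrNz; apply: val_geN; exact: n].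
Qed.

Lemma val_geM (R : realType) (k : local_field) (s t : R) (a b : k) :
  val_ge s a -> val_ge t b -> val_ge (s + t) (a * b).
Proof.
move=> [->|sa]; first by rewrite mul0r; left.
move=> [->|tb]; first by rewrite mulr0; left.
have [->|a0] := eqVneq a 0; first by rewrite mul0r; left.
have [->|b0] := eqVneq b 0; first by rewrite mulr0; left.
by right; rewrite lf_valM // intrD lerD.
Qed.

Lemma val_gt_ge (R : realType) (k : local_field) (s : R) (a : k) :
  val_gt s a <-> val_ge ((Num.floor s + 1)%:~R : R) a.
Proof. by rewrite /val_gt /val_ge ler_int lezD1 floor_lt_int. Qed.

Lemma val_gtD (R : realType) (k : local_field) (s : R) (a b : k) :
  val_gt s a -> val_gt s b -> val_gt s (a + b).
Proof. by rewrite !val_gt_ge; exact: val_geD. Qed.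

Lemma val_gtN (R : realType) (k : local_field) (s : R) (a : k) : val_gt s a -> val_gt s (- a).
Proof. by rewrite !val_gt_ge; exact: val_geN. Qed.

Lemma val_gt_sum (R : realType) (k : local_field) (s : R) (I : Type) (l : seq I)
    (P : pred I) (f : I -> k) :
  (forall i, P i -> val_gt s (f i)) -> val_gt s (\sum_(i <- l | P i) f i).
Proof. by move=> h; elim/big_ind: _ => // [|a b]; [left|exact: val_gtD]. Qed.

Lemma val_gt_mulz (R : realType) (k : local_field) (s : R) (a : k) (m : int) :
  val_gt s a -> val_gt s (a *~ m).
Proof. by rewrite !val_gt_ge; exact: val_ge_mulz. Qed.

Lemma val_ge_gtM (R : realType) (k : local_field) (s t : R) (a b : k) :
  val_ge s a -> val_gt t b -> val_gt (s + t) (a * b).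
Proof.
move=> [->|sa]; first by rewrite mul0r; left.
move=> [->|tb]; first by rewrite mulr0; left.
have [->|a0] := eqVneq a 0; first by rewrite mul0r; left.
have [->|b0] := eqVneq b 0; first by rewrite mulr0; left.
by right; rewrite lf_valM // intrD ler_ltD.
Qed.

Lemma val_gt_geM (R : realType) (k : local_field) (s t : R) (a b : k) :
  val_gt s a -> val_ge t b -> val_gt (s + t) (a * b).
Proof. by move=> sa tb; rewrite addrC mulrC; exact: val_ge_gtM. Qed.

Lemma val_ge_nat (R : realType) (k : local_field) (m : nat) : val_ge (0 : R) (m%:R : k).
Proof. by apply: (@val_ge_mulz R k 0 1 m); right; rewrite lf_val1. Qed.

Lemma int_ring_nat (k : local_field) (m : nat) : int_ring (m%:R : k).
Proof.
elim: m => [|m IH]; first by left.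
have [e|ne] := eqVneq (m.+1%:R : k) 0; first by left.
move: IH ne; rewrite -natr1; have [->|m0 [/eqP|vm]] := eqVneq (m%:R : k) 0.
- by rewrite add0r; right; rewrite lf_val1.
- by rewrite (negPf m0).
- by move=> ne; right; apply: le_trans (lf_valD m0 (oner_neq0 k) ne);
    rewrite lf_val1 le_min vm lexx.
Qed.

(** A natural number below p reduces to a nonzero element of the residue
    field. *)
Lemma small_nat_unit (k : local_field) (p m : nat) :
  p \in [pchar (residue k)] -> (0 < m < p)%N ->
  m%:R != 0 :> k /\ lf_val (m%:R : k) = 0.
Proof.
move=> hp /andP[m0 mp].
have red_nat j : lf_red (j%:R : k) = j%:R.
  elim: j => [|j IH]; first by apply/lf_red_ker; left.
  by rewrite -!natr1 lf_redD ?IH ?lf_red1 //; [exact: int_ring_nat|right; rewrite lf_val1].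
have nmax : ~ max_ideal (m%:R : k).
  move/(lf_red_ker (int_ring_nat k m)); rewrite red_nat => /eqP.
  rewrite -(dvdn_pcharf hp) => /(dvdn_leq m0); lia.
split; first by apply/eqP => e; apply: nmax; left.
have [e|v0] := int_ring_nat k m; first by case: nmax; left.
by apply/eqP; rewrite eq_le v0 andbT leNgt; apply/negP => v; apply: nmax; right.
Qed.

(** A point x defines the norm min_j (val u_j - x_j) on row vectors. These
    predicates say that A raises this norm by at least r, respectively by more
    than r; on trace-zero matrices they are the two filtrations. *)
Definition mx_ge (R : realType) (k : local_field) (n : nat) (x : 'rV[R]_n) (r : R)
  (A : 'M[k]_n) : Prop := forall i j, val_ge (r - x 0 i + x 0 j) (A i j).
Definition mx_gt (R : realType) (k : local_field) (n : nat) (x : 'rV[R]_n) (r : R)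
  (A : 'M[k]_n) : Prop := forall i j, val_gt (r - x 0 i + x 0 j) (A i j).

Lemma filtE (R : realType) (k : local_field) (n : nat) (x : 'rV[R]_n) (r : R) (A : 'M[k]_n) :
  filt k x r A <-> sl k n A /\ mx_ge x r A.
Proof.
split=> [[slA dA oA]|[slA gA]].
  split=> // i j; have [<-|ij] := eqVneq i j.
    have := dA (fun l => (l == i)%:R); rewrite /dchar (bigD1 i) //= eqxx mulr1z.
    rewrite big1 => [|l /negPf->]; last by rewrite mulr0z.
    by rewrite addr0 subrK.
  have [m rm [->|mA]] := oA i j ij; first by left.
  right; move: rm; rewrite /aff_eval /= => rm; have : (m%:~R : R) <= (lf_val (A i j))%:~R by
    rewrite ler_int.
  by lra.
split=> // [c|i j ij].
  apply: val_ge_sum => i _; apply: val_ge_mulz.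
  by have := gA i i; rewrite subrK.
have [->|vA] := gA i j.
  exists (Num.ceil (r - x 0 i + x 0 j)); last by left.
  rewrite /aff_eval /=; have := Num.Theory.ceil_ge (r - x 0 i + x 0 j); lra.
exists (lf_val (A i j)); last by right.
by rewrite /aff_eval /=; lra.
Qed.

Lemma filt_plusE (R : realType) (k : local_field) (n : nat) (x : 'rV[R]_n) (r : R) (A :
  'M[k]_n) :
  filt_plus k x r A <-> sl k n A /\ mx_gt x r A.
Proof.
split=> [[slA dA oA]|[slA gA]].
  split=> // i j; have [<-|ij] := eqVneq i j.
    have := dA (fun l => (l == i)%:R); rewrite /dchar (bigD1 i) //= eqxx mulr1z.
    rewrite big1 => [|l /negPf->]; last by rewrite mulr0z.
    by rewrite addr0 subrK.
  have [m rm [->|mA]] := oA i j ij; first by left.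
  right; move: rm; rewrite /aff_eval /= => rm; have : (m%:~R : R) <= (lf_val (A i j))%:~R by
    rewrite ler_int.
  by lra.
split=> // [c|i j ij].
  apply: val_gt_sum => i _; apply: val_gt_mulz.
  by have := gA i i; rewrite subrK.
have [->|vA] := gA i j.
  exists (Num.floor (r - x 0 i + x 0 j) + 1); last by left.
  rewrite /aff_eval /=; have := Num.Theory.floorD1_gt (r - x 0 i + x 0 j); lra.
exists (lf_val (A i j)); last by right.
by rewrite /aff_eval /=; lra.
Qed.

Lemma mx_geM (R : realType) (k : local_field) (n : nat) (x : 'rV[R]_n) (r s : R) (A B :
  'M[k]_n) :
  mx_ge x r A -> mx_ge x s B -> mx_ge x (r + s) (A *m B).
Proof.
move=> gA gB i j; rewrite mxE; apply: val_ge_sum => l _.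
by rewrite (_ : _ + _ = (r - x 0 i + x 0 l) + (s - x 0 l + x 0 j)); [exact: val_geM|lra].
Qed.

Lemma mx_ge_gtM (R : realType) (k : local_field) (n : nat) (x : 'rV[R]_n) (r s : R) (A B :
  'M[k]_n) :
  mx_ge x r A -> mx_gt x s B -> mx_gt x (r + s) (A *m B).
Proof.
move=> gA gB i j; rewrite mxE; apply: val_gt_sum => l _.
by rewrite (_ : _ + _ = (r - x 0 i + x 0 l) + (s - x 0 l + x 0 j)); [exact: val_ge_gtM|lra].
Qed.

Lemma mx_gt_geM (R : realType) (k : local_field) (n : nat) (x : 'rV[R]_n) (r s : R) (A B :
  'M[k]_n) :
  mx_gt x r A -> mx_ge x s B -> mx_gt x (r + s) (A *m B).
Proof.
move=> gA gB i j; rewrite mxE; apply: val_gt_sum => l _.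
by rewrite (_ : _ + _ = (r - x 0 i + x 0 l) + (s - x 0 l + x 0 j)); [exact: val_gt_geM|lra].
Qed.

(** * Filtrations at points of the building *)

Lemma SL_unitmx (F : fieldType) (n : nat) (g : 'M[F]_n) : SL F n g -> g \in unitmx.
Proof. by move=> dg; rewrite unitmxE [\det g]dg unitr1. Qed.

Lemma Ad_mulmx (F : fieldType) (n : nat) (g h A : 'M[F]_n) :
  g \in unitmx -> h \in unitmx -> Ad (g *m h) A = Ad g (Ad h A).
Proof.
move=> gu hu; have ghu : g *m h \in unitmx by rewrite unitmx_mul gu.
apply: (can_inj (mulmxK ghu)); rewrite /Ad mulmxKV // !mulmxA mulmxKV //.
by rewrite mulmxKV.
Qed.

Lemma Ad1 (F : fieldType) (n : nat) (A : 'M[F]_n) : Ad 1%:M A = A.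
Proof. by rewrite /Ad invmx1 mul1mx mulmx1. Qed.

Lemma AdK (F : fieldType) (n : nat) (g A : 'M[F]_n) : g \in unitmx -> Ad (invmx g) (Ad g A) = A.
Proof. by move=> gu; rewrite -Ad_mulmx ?unitmx_inv // mulVmx // Ad1. Qed.

Lemma Ad_inj (F : fieldType) (n : nat) (g : 'M[F]_n) : g \in unitmx -> injective (Ad g).
Proof. by move=> gu; apply: can_inj (fun A => AdK A gu). Qed.

Lemma AdM (F : fieldType) (n : nat) (g A B : 'M[F]_n) :
  g \in unitmx -> Ad g A *m Ad g B = Ad g (A *m B).
Proof. by move=> gu; rewrite /Ad !mulmxA mulmxKV. Qed.

Lemma Ad_tr (F : fieldType) (n : nat) (g A : 'M[F]_n) : g \in unitmx -> \tr (Ad g A) = \tr A.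
Proof. by move=> gu; rewrite /Ad mxtrace_mulC mulmxA mulVmx // mul1mx. Qed.

(** The inverse is the adjugate. Each term of a cofactor is a product of
    entries along a permutation, and the bounds x_j - x_i on the entries
    telescope along it. *)
Lemma stabilizerV (R : realType) (k : local_field) (n : nat) (x : 'rV[R]_n) (p : 'M[k]_n) :
  stabilizer k x p -> stabilizer k x (invmx p).
Proof.
move=> [dp ip]; have pu := SL_unitmx dp; split.
  by rewrite /SL /= det_inv [\det p]dp invr1.
move=> i j; rewrite /invmx pu [\det p]dp invr1 scale1r mxE expand_cofactor.
apply: val_ge_sum => s /eqP sji.
have sgn (a : k) (t : R) (b : bool) : val_ge t a -> val_ge t ((-1) ^+ b * a).
  by case: b; rewrite ?expr1 ?expr0 ?mulN1r ?mul1r //; exact: val_geN.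
apply: sgn.
have -> : x 0 j - x 0 i = \sum_(l | j != l) (x 0 (s l) - x 0 l).
  rewrite sumrB; have := perm_inj (s := s).
  have e1 : \sum_l x 0 (s l) = \sum_l x 0 l by rewrite [RHS](reindex_inj (@perm_inj _ s)).
  move: e1; rewrite (bigD1 j) //= sji [in RHS](bigD1 j) //=.
  rewrite (eq_bigl (fun l => j != l)) => [|l]; last by rewrite eq_sym.
  rewrite [in X in _ = _ + X -> _](eq_bigl (fun l => j != l)) => [|l]; last by rewrite eq_sym.
  by move=> e _; lra.
elim/big_rec2: _ => [|l a t _ IH]; first by right; rewrite lf_val1.
by apply: val_geM => //; exact: ip.
Qed.

Lemma mx_ge_stabilizer (R : realType) (k : local_field) (n : nat) (x : 'rV[R]_n) (p : 'M[k]_n) :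
  stabilizer k x p -> mx_ge x 0 p.
Proof. by move=> [_ ip] i j; rewrite add0r addrC; exact: ip. Qed.

Lemma filt_stabilizer (R : realType) (k : local_field) (n : nat) (x : 'rV[R]_n) (r : R)
    (p A : 'M[k]_n) :
  stabilizer k x p -> filt k x r A -> filt k x r (Ad p A).
Proof.
move=> sp /filtE[slA gA]; apply/filtE; split.
  by rewrite /sl /= Ad_tr //; case: sp => /SL_unitmx.
rewrite -[r]addr0 -[r]add0r; apply: mx_geM; last exact/mx_ge_stabilizer/stabilizerV.
by apply: mx_geM => //; exact: mx_ge_stabilizer.
Qed.

Lemma filt_plus_stabilizer (R : realType) (k : local_field) (n : nat) (x : 'rV[R]_n) (r : R)
    (p A : 'M[k]_n) :
  stabilizer k x p -> filt_plus k x r A -> filt_plus k x r (Ad p A).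
Proof.
move=> sp /filt_plusE[slA gA]; apply/filt_plusE; split.
  by rewrite /sl /= Ad_tr //; case: sp => /SL_unitmx.
rewrite -[r]addr0 -[r]add0r; apply: mx_gt_geM; last exact/mx_ge_stabilizer/stabilizerV.
by apply: mx_ge_gtM => //; exact: mx_ge_stabilizer.
Qed.

Lemma Ad_monomial (F : fieldType) (n : nat) (m A : 'M[F]_n) (s : {perm 'I_n}) i j :
  m \in unitmx -> (forall i j, (m i j != 0) = (i == s j)) ->
  Ad m A (s i) (s j) = m (s i) i * A i j / m (s j) j.
Proof.
move=> mu ms; have mj : m (s j) j != 0 by rewrite ms.
have m0 a b : a != s b -> m a b = 0 by rewrite -ms negbK => /eqP.
apply: (mulIf mj); rewrite mulfVK //.
have : Ad m A *m m = m *m A by rewrite /Ad mulmxKV.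
move: (Ad m A) => B /matrixP/(_ (s i) j); rewrite !mxE (bigD1 (s j)) //= big1 ?addr0 => [|l
  lj]; last by rewrite (m0 l) ?mulr0.
move=> ->; rewrite (bigD1 i) //= big1 ?addr0 // => l li.
by rewrite (m0 _ l) ?mul0r // (inj_eq perm_inj) eq_sym.
Qed.

Lemma filt_normalizer (R : realType) (k : local_field) (n : nat) (x y : 'rV[R]_n) (r : R)
    (m A : 'M[k]_n) :
  SL k n m -> normalizer_act m x y -> filt k x r A -> filt k y r (Ad m A).
Proof.
move=> dm [s [ms yE]] /filtE[slA gA]; have mu := SL_unitmx dm.
apply/filtE; split; first by rewrite /sl /= Ad_tr.
move=> i0 j0; rewrite -(permKV s i0) -(permKV s j0).
set i := (s^-1)%g i0; set j := (s^-1)%g j0; rewrite (Ad_monomial _ _ _ mu ms) !yE.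
have [mi mj] : m (s i) i != 0 /\ m (s j) j != 0 by rewrite !ms.
have -> : r - (x 0 i - (lf_val (m (s i) i))%:~R) + (x 0 j - (lf_val (m (s j) j))%:~R) =
  (lf_val (m (s i) i))%:~R + (r - x 0 i + x 0 j) + (lf_val (m (s j) j)^-1)%:~R :> R.
  by rewrite lf_valV // rmorphN /=; lra.
by apply: val_geM; [apply: val_geM => //|]; right.
Qed.

Lemma filt_plus_normalizer (R : realType) (k : local_field) (n : nat) (x y : 'rV[R]_n) (r : R)
    (m A : 'M[k]_n) :
  SL k n m -> normalizer_act m x y -> filt_plus k x r A -> filt_plus k y r (Ad m A).
Proof.
move=> dm [s [ms yE]] /filt_plusE[slA gA]; have mu := SL_unitmx dm.
apply/filt_plusE; split; first by rewrite /sl /= Ad_tr.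
move=> i0 j0; rewrite -(permKV s i0) -(permKV s j0).
set i := (s^-1)%g i0; set j := (s^-1)%g j0; rewrite (Ad_monomial _ _ _ mu ms) !yE.
have [mi mj] : m (s i) i != 0 /\ m (s j) j != 0 by rewrite !ms.
have -> : r - (x 0 i - (lf_val (m (s i) i))%:~R) + (x 0 j - (lf_val (m (s j) j))%:~R) =
  (lf_val (m (s i) i))%:~R + (r - x 0 i + x 0 j) + (lf_val (m (s j) j)^-1)%:~R :> R.
  by rewrite lf_valV // rmorphN /=; lra.
by apply: val_gt_geM; [apply: val_ge_gtM => //|]; right.
Qed.

Lemma bpoint_refl (R : realType) (k : local_field) (n : nat) (g : 'M[k]_n) (x : 'rV[R]_n) :
  SL k n g -> apartment R n x -> bpoint g x (g, x).
Proof.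
move=> dg ax; split=> //; exists 1%:M; split; first by rewrite /SL /= det1.
  exists 1%g; split=> [i j|j]; rewrite perm1 mxE ?eqxx /=; last by rewrite lf_val1 subr0.
  by case: (i == j); rewrite ?oner_neq0 ?eqxx.
rewrite mulmx1 mulVmx ?SL_unitmx //; split=> [|i j]; first by rewrite /SL /= det1.
rewrite mxE; case: eqP => [->|_]; last by left.
by right; rewrite lf_val1 subrr.
Qed.

Lemma SL_inv (F : fieldType) (n : nat) (g : 'M[F]_n) : SL F n g -> SL F n (invmx g).
Proof. by rewrite /SL /= det_inv => ->; rewrite invr1. Qed.

(** What makes g_{gx,r} = Ad(g) g_{x,r} well defined: a family of sets on the
    apartment that is compatible with G_x and N(T) extends to the building. *)
Lemma transport_bpoint (R : realType) (k : local_field) (n : nat)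
    (Phi : 'rV[R]_n -> set 'M[k]_n) (g g' : 'M[k]_n) (x x' : 'rV[R]_n) :
  (forall x p A, stabilizer k x p -> Phi x A -> Phi x (Ad p A)) ->
  (forall x y m A, SL k n m -> normalizer_act m x y -> Phi x A -> Phi y (Ad m A)) ->
  SL k n g -> apartment R n x -> SL k n g' -> bpoint g x = bpoint g' x' ->
  Ad g' @` Phi x' `<=` Ad g @` Phi x.
Proof.
move=> stP nP dg ax dg' e.
have := bpoint_refl dg ax; rewrite e => -[_ _ [m /= [dm nm sp]]] _ [A PA <-].
set p := invmx g' *m g *m m in sp.
have [gu gu' mu] : [/\ g \in unitmx, g' \in unitmx & m \in unitmx] by split; exact: SL_unitmx.
have pu : p \in unitmx by case: sp => /SL_unitmx.
exists (Ad m (Ad (invmx p) A)).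
  by apply: nP nm _ => //; apply: stP => //; exact: stabilizerV.
rewrite -!Ad_mulmx ?unitmx_mul ?unitmx_inv ?gu ?mu ?pu //; congr Ad.
have -> : g *m m = g' *m p by rewrite /p !mulmxA mulmxV // mul1mx.
by rewrite mulmxK.
Qed.

Lemma bfiltE (R : realType) (k : local_field) (n : nat) (g : 'M[k]_n) (x : 'rV[R]_n) (r : R) :
  SL k n g -> apartment R n x -> bfilt (bpoint g x) r = Ad g @` filt k x r.
Proof.
move=> dg ax; rewrite eqEsubset; split=> [A [g' [x' [dg' ax' e]]]|A iA]; last by exists g, x.
apply: (@transport_bpoint R k n (fun x => filt k x r)) => //.
  by move=> *; exact: filt_stabilizer.
by move=> *; apply: filt_normalizer; eassumption.
Qed.

Lemma bfilt_plusE (R : realType) (k : local_field) (n : nat) (g : 'M[k]_n) (x : 'rV[R]_n) (r :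
  R) :
  SL k n g -> apartment R n x -> bfilt_plus (bpoint g x) r = Ad g @` filt_plus k x r.
Proof.
move=> dg ax; rewrite eqEsubset; split=> [A [g' [x' [dg' ax' e]]]|A iA]; last by exists g, x.
apply: (@transport_bpoint R k n (fun x => filt_plus k x r)) => //.
  by move=> *; exact: filt_plus_stabilizer.
by move=> *; apply: filt_plus_normalizer; eassumption.
Qed.

(** * Duality of the filtrations *)

(** g_{x,-r} is the dual of g_{x,r+} under the trace form: pairing with
    elementary matrices bounds the off-diagonal entries and the differences of
    diagonal ones, and a trace-zero diagonal is recovered from its differences
    since n is a unit. Thus g_{x,-r} depends only on g_{x,r+}. *)
Lemma filt_dual (R : realType) (k : local_field) (n : nat) (x : 'rV[R]_n) (r : R) (A :
  'M[k]_n) :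
  lf_val (n%:R : k) = 0 -> n%:R != 0 :> k ->
  filt k x (- r) A <->
  sl k n A /\ forall B, filt_plus k x r B -> val_gt (0 : R) (\tr (A *m B)).
Proof.
move=> vn n0; split=> [/filtE[slA gA]|[slA dA]].
  split=> // B /filt_plusE[_ gB]; apply: val_gt_sum => i _.
  by have := mx_ge_gtM gA gB i i; rewrite addNr sub0r addNr.
apply/filtE; split=> //.
have entry (i j : 'I_n) : i != j -> val_ge (- r - x 0 i + x 0 j) (A i j).
  move=> ij; have [->|Aij] := eqVneq (A i j) 0; first by left.
  right; rewrite leNgt; apply/negP => lt.
  (* With this valuation, B has just enough depth and A i j * a is a unit. *)
  have [a a0 va] := lf_val_onto k (- lf_val (A i j)).
  pose B : 'M[k]_n := a *: delta_mx j i.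
  have trB : \tr (A *m B) = A i j * a.
    rewrite /mxtrace (bigD1 i) //= big1 => [|l li].
      rewrite addr0 mxE (bigD1 j) //= big1 => [|l lj].
        by rewrite !mxE !eqxx mulr1 addr0.
      by rewrite !mxE (negPf lj) mulr0 mulr0.
    by rewrite mxE big1 // => l' _; rewrite !mxE (negPf li) andbF !mulr0.
  have : filt_plus k x r B.
    apply/filt_plusE; split=> [|u w].
      rewrite /sl /= mxtraceZ /mxtrace big1 ?mulr0 // => l _; rewrite mxE.
      by case: (eqVneq l j) => //= ->; rewrite eq_sym (negPf ij).
    rewrite !mxE; case: (eqVneq u j) => [->|]; last by rewrite mulr0; left.
    case: (eqVneq w i) => [->|]; last by rewrite mulr0; left.
    by rewrite mulr1; right; rewrite va rmorphN /=; lra.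
  move/dA; rewrite trB => -[/eqP|]; first by rewrite mulf_eq0 (negPf Aij) (negPf a0).
  by rewrite lf_valM // va subrr ltxx.
have diag (i j : 'I_n) : val_ge (- r) (A i i - A j j).
  have [->|ij] := eqVneq i j; first by rewrite subrr; left.
  have [->|Aij] := eqVneq (A i i - A j j) 0; first by left.
  right; rewrite leNgt; apply/negP => lt.
  have [a a0 va] := lf_val_onto k (- lf_val (A i i - A j j)).
  pose B : 'M[k]_n := a *: (delta_mx i i - delta_mx j j).
  have trd (C : 'M[k]_n) (l : 'I_n) : \tr (C *m delta_mx l l) = C l l.
    rewrite /mxtrace (bigD1 l) //= big1 => [|l' ll'].
      rewrite addr0 mxE (bigD1 l) //= big1 => [|l' ll'].
        by rewrite !mxE !eqxx mulr1 addr0.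
      by rewrite !mxE (negPf ll') mulr0.
    by rewrite mxE big1 // => l'' _; rewrite !mxE (negPf ll') andbF mulr0.
  have trB : \tr (A *m B) = (A i i - A j j) * a.
    by rewrite /B -scalemxAr mxtraceZ mulmxBr raddfB /= !trd mulrC.
  have : filt_plus k x r B.
    apply/filt_plusE; split=> [|u w].
      rewrite /sl /= mxtraceZ raddfB /=.
      by have := trd 1%:M i; have := trd 1%:M j; rewrite !mul1mx => -> ->;
        rewrite !mxE !eqxx subrr mulr0.
    rewrite !mxE; case: (eqVneq u w) => [<-|uw].
      rewrite subrK !andbb.
      have : val_gt r a by right; rewrite va rmorphN /=; lra.
      move=> va'; case: (u == i); case: (u == j); rewrite /= ?subrr ?subr0 ?sub0r ?mulr0
        ?mulr1 ?mulrN1 //.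
      - by left.
      - exact: val_gtN.
      - by left.
    suff -> : ((u == i) && (w == i))%:R - ((u == j) && (w == j))%:R = 0 :> k by rewrite mulr0;
      left.
    have h l : (u == l) && (w == l) = false.
      by apply/negP => /andP[/eqP ul /eqP wl]; case/eqP: uw; rewrite ul wl.
    by rewrite !h subrr.
  move/dA; rewrite trB => -[/eqP|]; first by rewrite mulf_eq0 (negPf Aij) (negPf a0).
  by rewrite lf_valM // va subrr ltxx.
move=> i j; have [<-|/entry//] := eqVneq i j; rewrite subrK.
have : val_ge (- r) (\sum_j (A i i - A j j)) by apply: val_ge_sum => l _; exact: diag.
rewrite sumrB sumr_const card_ord [X in _ - X](_ : _ = 0) // subr0 -mulr_natl.
have [->|Aii] := eqVneq (A i i) 0; first by left.
case=> [/eqP|]; first by rewrite mulf_eq0 (negPf n0) (negPf Aii).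
by rewrite lf_valM // vn add0r; right.
Qed.

(** As the trace form is invariant under conjugation, the dual description
    holds at every point of the building. *)
Lemma bfilt_dual (R : realType) (k : local_field) (n : nat) (g h : 'M[k]_n) (x y : 'rV[R]_n)
  (r : R) :
  lf_val (n%:R : k) = 0 -> n%:R != 0 :> k ->
  SL k n g -> SL k n h -> apartment R n x -> apartment R n y ->
  bfilt_plus (bpoint h y) r `<=` bfilt_plus (bpoint g x) r ->
  bfilt (bpoint g x) (- r) `<=` bfilt (bpoint h y) (- r).
Proof.
move=> vn n0 dg dh ax ay; rewrite !bfilt_plusE // !bfiltE // => sub _ [A fA <-].
have [gu hu] : g \in unitmx /\ h \in unitmx by split; exact: SL_unitmx.
have [slA dA] := (filt_dual x r A vn n0).1 fA.
have hVu : invmx h \in unitmx by rewrite unitmx_inv.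
exists (Ad (invmx h) (Ad g A)); last by rewrite -[X in _ = X](AdK _ hVu) invmxK.
apply/(filt_dual _ _ _ vn n0); split; first by rewrite /sl /= !Ad_tr.
move=> B fB; have [] := sub (Ad h B); first by exists B.
move=> B' fB' e; rewrite -(AdK B hu) AdM // Ad_tr // -e AdM // Ad_tr //.
exact: dA.
Qed.

(** * Facets and their directions *)

(** The signs of psi - r at all affine roots psi determine the filtrations at
    level r, and conversely; so this set is the trace of a generalized facet on
    an apartment. *)
Definition same_side (R : realType) (n : nat) (r : R) (x : 'rV[R]_n) : set 'rV[R]_n :=
  [set z | apartment R n z /\ forall psi, affine_roots n psi ->
     (r <= aff_eval psi z) = (r <= aff_eval psi x) /\
     (r < aff_eval psi z) = (r < aff_eval psi x)].

Lemma filt_root (R : realType) (k : local_field) (n : nat) (x : 'rV[R]_n) (r : R)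
    (psi : affine_root n) (a : k) :
  affine_roots n psi -> a != 0 -> lf_val a = psi.2 ->
  (filt k x r (a *: delta_mx psi.1.1 psi.1.2) <-> r <= aff_eval psi x) /\
  (filt_plus k x r (a *: delta_mx psi.1.1 psi.1.2) <-> r < aff_eval psi x).
Proof.
case: psi => -[i j] m /= ij a0 va; rewrite /affine_roots /= in ij.
have tr0 : sl k n (a *: delta_mx i j).
  rewrite /sl /= mxtraceZ /mxtrace big1 ?mulr0 // => l _; rewrite mxE.
  by case: (eqVneq l i) => //= ->; rewrite (negPf ij).
have off u w : (u, w) != (i, j) -> (a *: delta_mx i j : 'M[k]_n) u w = 0.
  by rewrite xpair_eqE => /negPf h; rewrite !mxE h mulr0.
have on : (a *: delta_mx i j : 'M[k]_n) i j = a by rewrite !mxE !eqxx mulr1.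
rewrite /aff_eval /=; split; split.
- move=> /filtE[_ /(_ i j)]; rewrite on => -[/eqP|]; first by rewrite (negPf a0).
  by rewrite va; lra.
- move=> h; apply/filtE; split=> // u w; have [[-> ->]|/off->] := eqVneq (u, w) (i, j);
    last by left.
  by rewrite on; right; rewrite va; lra.
- move=> /filt_plusE[_ /(_ i j)]; rewrite on => -[/eqP|]; first by rewrite (negPf a0).
  by rewrite va; lra.
- move=> h; apply/filt_plusE; split=> // u w; have [[-> ->]|/off->] := eqVneq (u, w) (i, j);
    last by left.
  by rewrite on; right; rewrite va; lra.
Qed.

Lemma same_sideP (R : realType) (k : local_field) (n : nat) (x z : 'rV[R]_n) (r : R) :
  apartment R n z ->
  (filt k z r = filt k x r /\ filt_plus k z r = filt_plus k x r) <-> same_side r x z.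
Proof.
move=> az; split=> [[e1 e2]|[_ h]].
  split=> // psi hpsi; have [a a0 va] := lf_val_onto k psi.2.
  have [p1 p2] := filt_root z r hpsi a0 va; have [q1 q2] := filt_root x r hpsi a0 va.
  by split; apply/idP/idP; rewrite -?p1 -?p2 -?q1 -?q2 ?e1 ?e2.
split; rewrite eqEsubset; split=> A [slA dA oA]; split=> // i j ij;
  have [m rm iA] := oA i j ij; exists m => //;
  have [] := h (i, j, m) ij; by [move=> <- _|move=> -> _|move=> _ <-|move=> _ ->].
Qed.

Lemma apt_section_same_side (R : realType) (k : local_field) (n : nat) (r : R)
    (C : set (building_pt R k n)) (g : 'M[k]_n) (x : 'rV[R]_n) :
  gen_facet r C -> SL k n g -> apartment R n x -> C (bpoint g x) ->
  apt_section C g = same_side r x.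
Proof.
move=> [y by_ ->] dg ax [bx ex epx].
have Adinj : injective (image^~ (Ad g) : set 'M[k]_n -> set 'M[k]_n).
  move=> A B AB; rewrite eqEsubset; have gi := Ad_inj (SL_unitmx dg).
  split=> a ha.
    by have : (Ad g @` B) (Ad g a); [rewrite -AB; exists a|move=> -[b Bb /gi <-]].
  by have : (Ad g @` A) (Ad g a); [rewrite AB; exists a|move=> -[b Bb /gi <-]].
rewrite eqEsubset; split=> z.
  move=> [az [bz ez epz]]; apply/(same_sideP k x r az); split; apply: Adinj.
    by rewrite /= -!bfiltE // ez ex.
  by rewrite /= -!bfilt_plusE // epz epx.
move=> /[dup] -[az _] /(same_sideP k x r az)[e1 e2]; split=> //; split.
- by exists g, z.
- by rewrite -ex !bfiltE // e1.
- by rewrite -epx !bfilt_plusE // e2.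
Qed.

(** A number at positive distance from the integers stays between the same
    consecutive integers after a small move, and an integer leaves the other
    integers at distance at least 1. *)
Lemma perturb (R : realType) (f d : R) :
  \forall e \near 0^'+, forall m : int, f + m%:~R != 0 ->
    (0 < f + m%:~R + e * d) = (0 < f + m%:~R) /\ f + m%:~R + e * d != 0.
Proof.
have [d0 d00 dP] : exists2 d0 : R, 0 < d0 & forall m : int, f + m%:~R != 0 ->
  d0 <= `|f + m%:~R|.
  pose a := Num.floor f; pose g := f - a%:~R.
  have g0 : 0 <= g by rewrite subr_ge0 floor_le_tmp.
  have g1 : g < 1 by have := floorD1_gt f; rewrite /g /a intrD; lra.
  have [gE|gn] := eqVneq g 0.
    exists 1 => // m; have -> : f + m%:~R = (a + m)%:~R by rewrite intrD; move: gE;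
      rewrite /g; lra.
    rewrite intr_eq0 => am; rewrite -intr_norm -[1]/(1%:~R) ler_int; lia.
  have gp : 0 < g by rewrite lt_neqAle eq_sym gn.
  exists (Num.min g (1 - g)); first by rewrite lt_min gp subr_gt0.
  move=> m _; have -> : f + m%:~R = g + (a + m)%:~R by rewrite /g intrD; lra.
  rewrite ge_min; case: (lerP 0 (a + m)) => am.
    have am' : (0 : R) <= (a + m)%:~R by rewrite ler0z.
    by apply/orP; left; rewrite ger0_norm; lra.
  have am' : (a + m)%:~R <= (-1 : R) by rewrite -[-1]/((-1)%:~R) ler_int; lia.
  by apply/orP; right; rewrite ler0_norm; lra.
near=> e.
have e0 : 0 < e by near: e; exact: nbhs_right_gt.
have ed : e * (`|d| + 1) < d0.
  rewrite -ltr_pdivlMr ?ltr_wpDl //; near: e; apply: nbhs_right_lt.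
  by rewrite divr_gt0 // ltr_wpDl.
move=> m /dP fm.
have : `|e * d| < `|f + m%:~R|.
  apply: lt_le_trans fm; apply: le_lt_trans ed.
  by rewrite normrM gtr0_norm // ler_pM2l // lerDl.
move: (f + m%:~R) (e * d) => u w.
case: (lerP 0 u) => u0; [rewrite (ger0_norm u0)|rewrite (ltr0_norm u0)];
  rewrite ltr_norml => /andP[? ?].
  by split; [apply/idP/idP; lra|apply/eqP; lra].
by split; [apply/idP/idP; lra|apply/eqP; lra].
Unshelve. all: by end_near.
Qed.

(** A neighbourhood of a row vector contains a product of neighbourhoods of its
    finitely many coordinates. *)
Lemma line_continuous (R : realType) (n : nat) (x d : 'rV[R]_n) :
  continuous (fun t : R => x + t *: d).
Proof.
suff h (t : R) : (fun t : R => x + t *: d) @ t --> x + t *: d by exact: h.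
move=> A [P nP sPA].
have : \forall s \near t, forall ij : 'I_1 * 'I_n, P ij.1 ij.2 ((x + s *: d) ij.1 ij.2).
  near=> s; near: s; apply: filter_forall => -[i j] /=.
  have : (fun s : R => x i j + s * d i j) @ t --> x i j + t * d i j.
    by apply: cvgD; [exact: cvg_cst|apply: cvgM; [exact: cvg_id|exact: cvg_cst]].
  move=> /(_ (P i j)); have := nP i j; rewrite !mxE => h /(_ h).
  by move=> hs; near=> s; rewrite !mxE; near: s; exact: hs.
move=> hs; suff : \forall s \near t, A (x + s *: d) by [].
near=> s; apply: sPA => i j.
suff h : forall ij : 'I_1 * 'I_n, P ij.1 ij.2 ((x + s *: d) ij.1 ij.2) by exact: (h (i, j)).
by near: s; exact: hs.
Unshelve. all: by end_near.
Qed.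

Lemma star_connected (R : realType) (n : nat) (S : set 'rV[R]_n) (x : 'rV[R]_n) :
  (forall z, S z -> forall t : R, 0 <= t <= 1 -> S (x + t *: (z - x))) -> connected S.
Proof.
move=> st; pose f (z : 'rV[R]_n) (t : R) := x + t *: (z - x).
have -> : S = \bigcup_(z in S) (f z @` `[0, 1]).
  rewrite eqEsubset; split=> [z Sz|z [y Sy [t]]].
    by exists z => //; exists 1; rewrite /= ?in_itv /= ?ler01 ?lexx // /f scale1r addrC subrK.
  by rewrite /= in_itv /= => t01 <-; exact: st.
apply: bigcup_connected.
  exists x => z Sz; exists 0; rewrite /= ?in_itv /= ?ler01 ?lexx //.
  by rewrite /f scale0r addr0.
move=> z Sz; apply: connected_continuous_connected; first exact: segment_connected.
by apply: continuous_subspaceT => t; exact: line_continuous.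
Qed.

Lemma conv_lt (R : realType) (a b r t : R) :
  0 <= t -> t <= 1 -> a < r -> b < r -> (1 - t) * a + t * b < r.
Proof.
move=> t0 t1 ar br; have [->|tn] := eqVneq t 0; first by rewrite subr0 mul1r mul0r addr0.
have tp : 0 < t by rewrite lt_neqAle eq_sym tn.
have : 0 < t * (r - b) by rewrite mulr_gt0 // subr_gt0.
have : 0 <= (1 - t) * (r - a) by rewrite mulr_ge0 // subr_ge0 // ltW.
lra.
Qed.

Lemma same_side_convex (R : realType) (n : nat) (r : R) (x z : 'rV[R]_n) (t : R) :
  apartment R n x -> same_side r x z -> 0 <= t <= 1 -> same_side r x (x + t *: (z - x)).
Proof.
move=> ax [az h] /andP[t0 t1]; split.
  rewrite /apartment /=; under eq_bigr do rewrite !mxE.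
  by rewrite big_split /= -mulr_sumr sumrB [X in X + _]ax [X in X - _]az ax subrr mulr0 addr0.
move=> psi hpsi; have [] := h psi hpsi.
have -> : aff_eval psi (x + t *: (z - x)) = (1 - t) * aff_eval psi x + t * aff_eval psi z.
  by rewrite /aff_eval !mxE; ring.
move: (aff_eval psi x) (aff_eval psi z) => a b e1 e2; split.
  apply/idP/idP => [h1|ra]; last by rewrite ra in e1; nra.
  rewrite leNgt; apply/negP => ar; move: e1; rewrite [RHS]leNgt ar /= => /negbT;
    rewrite -ltNge => br.
  by have := conv_lt t0 t1 ar br; lra.
apply/idP/idP => [h1|ra]; last first.
  rewrite ra in e2; have := @conv_lt _ (- a) (- b) (- r) t t0 t1; rewrite !ltrN2 => /(_ ra e2).
  by lra.
rewrite ltNge; apply/negP => ar; move: e2; rewrite [RHS]ltNge ar /= => /negbT;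
  rewrite -leNgt => br.
nra.
Qed.

(** The set is convex, hence connected, and its points satisfy the same
    equations psi = r as x. *)
Lemma same_side_sub_r_facet (R : realType) (n : nat) (r : R) (F : set 'rV[R]_n) (x : 'rV[R]_n) :
  r_facet r F -> F x -> apartment R n x /\ same_side r x `<=` F.
Proof.
move=> [Sg [x0 [_ sub lx0 ->]]] Fx.
have [ax e1 e2] : facet_locus r Sg x by apply: connected_component_sub Fx.
split=> //; rewrite (same_connected_component Fx).
apply: connected_component_max.
- by split.
- move=> z [az h]; split=> // psi Hp.
    by have [] := h psi (sub _ Hp); rewrite (e1 _ Hp) lexx ltxx => /idP rz /negbT;
      rewrite -leNgt => zr;
      apply/eqP; rewrite eq_le zr rz.
  move=> nHp ez; apply: (e2 psi) => //; have [] := h psi Hp; rewrite ez lexx ltxx.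
  move=> /esym rz /esym/negbT; rewrite -leNgt => zr.
  by apply/eqP; rewrite eq_le zr rz.
- apply: (@star_connected _ _ _ x) => z Sz t t01; exact: same_side_convex.
Qed.

Definition on_wall (R : realType) (n : nat) (r : R) (x : 'rV[R]_n) (i j : 'I_n) : Prop :=
  exists m : int, aff_eval (i, j, m) x = r.

(** The directions in which x can move while staying on every wall through
    it. *)
Definition face_space (R : realType) (n : nat) (r : R) (x : 'rV[R]_n)
    (U : {vspace 'rV[R]_n}) : Prop :=
  forall u, (u \in U) <->
    (\sum_i u 0 i = 0 /\ forall i j, i != j -> on_wall r x i j -> u 0 i = u 0 j).

(** The walls through x confine the set to x + U, and a small move along U keeps
    all signs: finitely many coordinate differences are involved, and [perturb]
    treats all integral translates of each at once. So its affine span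
    is the whole of x + U. *)
Lemma same_side_has_dim (R : realType) (n : nat) (r : R) (x : 'rV[R]_n)
    (U : {vspace 'rV[R]_n}) :
  apartment R n x -> face_space r x U -> has_dim (same_side r x) (\dim U).
Proof.
move=> ax fU; exists x, U; split=> //.
  move=> z [az h]; rewrite /affine_subspace /=; apply/fU; split.
    by under eq_bigr do rewrite !mxE; rewrite sumrB [X in X - _]az ax subrr.
  move=> i j ij [m em]; have [] := h (i, j, m) ij; rewrite em lexx ltxx => rz /negbT.
  rewrite -leNgt => zr; have : aff_eval (i, j, m) z = r by apply/eqP; rewrite eq_le zr rz.
  by move: em; rewrite /aff_eval !mxE /=; lra.
move=> p' U' sub u; rewrite /affine_subspace /= => /fU[su hu].
have [e e0 he] : exists2 e : R, 0 < e & same_side r x (x + e *: (u - x)).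
  have : \forall e \near 0^'+, forall ij : 'I_n * 'I_n, forall m : int,
      x 0 ij.1 - x 0 ij.2 - r + m%:~R != 0 ->
      (0 < x 0 ij.1 - x 0 ij.2 - r + m%:~R + e * ((u - x) 0 ij.1 - (u - x) 0 ij.2)) =
      (0 < x 0 ij.1 - x 0 ij.2 - r + m%:~R) /\
      x 0 ij.1 - x 0 ij.2 - r + m%:~R + e * ((u - x) 0 ij.1 - (u - x) 0 ij.2) != 0.
    near=> e; near: e; apply: filter_forall => ij; exact: perturb.
  move=> P; near (0 : R)^'+ => e; exists e; first by near: e; exact: nbhs_right_gt.
  have he : forall ij : 'I_n * 'I_n, forall m : int,
      x 0 ij.1 - x 0 ij.2 - r + m%:~R != 0 ->
      (0 < x 0 ij.1 - x 0 ij.2 - r + m%:~R + e * ((u - x) 0 ij.1 - (u - x) 0 ij.2)) =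
      (0 < x 0 ij.1 - x 0 ij.2 - r + m%:~R) /\
      x 0 ij.1 - x 0 ij.2 - r + m%:~R + e * ((u - x) 0 ij.1 - (u - x) 0 ij.2) != 0.
    by near: e; exact: P.
  have xd l : (x + e *: (u - x)) 0 l = x 0 l + e * (u - x) 0 l.
    by rewrite mxE [X in _ + X]mxE.
  split.
    rewrite /apartment /=; under eq_bigr do rewrite xd.
    by rewrite big_split /= -mulr_sumr su mulr0 addr0.
  move=> [[i j] m] /= ij; set a := aff_eval _ (x + _); set b := aff_eval _ x.
  pose f := x 0 i - x 0 j - r + m%:~R.
  have bE : b = r + f by rewrite /b /f /aff_eval /=; lra.
  have aE : a = r + f + e * ((u - x) 0 i - (u - x) 0 j).
    by rewrite /a /f /aff_eval /= !xd; lra.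
  have [f0|f0] := eqVneq f 0.
    have uij : (u - x) 0 i = (u - x) 0 j.
      by apply: hu => //; exists m; rewrite -[LHS]/b bE f0 addr0.
    by rewrite aE uij subrr mulr0 addr0 bE.
  have [] := he (i, j) m f0; rewrite /= -/f; set d := e * _ => e1 e2.
  have -> : a = r + (f + d) by rewrite aE -/d (addrA r f d).
  rewrite bE !ltrDl !lerDl e1 !le_eqVlt e1 ![0 == _]eq_sym (negPf e2).
  by rewrite (negPf f0).
have := sub _ he; have : same_side r x x by split.
move=> /sub; rewrite /affine_subspace /= => xp uep.
have : e *: (u - x) \in U'.
  by have := rpredB uep xp; rewrite opprB addrA subrK addrAC subrr add0r.
move=> /(memvZ e^-1); rewrite scalerA mulVf ?gt_eqF // scale1r => ux.
by have := rpredD ux xp; rewrite addrA subrK.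
Unshelve. all: by end_near.
Qed.

(** The quotient by the equivalence relation generated by e, with its universal
    property. When r is not an integer, lying on a common wall is not an
    equivalence relation on coordinates, whence the closure. *)
Lemma generated_quotient (n : nat) (e : rel 'I_n.+1) :
  exists q, exists c : 'I_n.+1 -> 'I_q.+1,
    [/\ forall a, exists i, c i = a,
        forall i j, e i j -> c i = c j &
        forall (T : Type) (f : 'I_n.+1 -> T), (forall i j, e i j -> f i = f j) ->
          forall i j, c i = c j -> f i = f j].
Proof.
pose e' := [rel i j | e i j || e j i].
have sc : connect_sym e' by apply: sym_connect_sym => i j; rewrite /= orbC.
pose J : {set 'I_n.+1} := [set fingraph.root e' i | i : 'I_n.+1]%SET.
have rJ i : fingraph.root e' i \in J by apply/imsetP; exists i.
have [q qE] : exists q, q.+1 = #|J| by exists #|J|.-1;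
  rewrite prednK // (cardD1 (fingraph.root e' ord0)) rJ.
exists q, (fun i => cast_ord (esym qE) (enum_rank_in (rJ ord0) (fingraph.root e' i))).
have cE i j : cast_ord (esym qE) (enum_rank_in (rJ ord0) (fingraph.root e' i)) =
    cast_ord (esym qE) (enum_rank_in (rJ ord0) (fingraph.root e' j)) -> connect e' i j.
  move=> /cast_ord_inj /(congr1 enum_val); rewrite !enum_rankK_in // => h.
  by apply/(fingraph.rootP sc).
split.
- move=> a; have := enum_valP (cast_ord qE a) => /imsetP[i _ ai]; exists i.
  by rewrite -ai enum_valK_in cast_ordK.
- move=> i j eij; congr (cast_ord _ (enum_rank_in _ _)); apply/(fingraph.rootP sc)/connect1.
  by rewrite /= eij.
- move=> T f hf i j /cE /connectP[p pp ->]; elim: p i pp => //= l p IH i /andP[h /IH <-].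
  by case/orP: h => /hf.
Qed.

(** Functions constant on the fibres of c are the image of an injection of
    R^(q+1), on which the sum of the coordinates is a nonzero linear form. *)
Lemma sum0_fiber_space (R : realType) (n q : nat) (r : R) (x : 'rV[R]_n.+1)
    (c : 'I_n.+1 -> 'I_q.+1) :
  (forall a, exists i, c i = a) ->
  exists U : {vspace 'rV[R]_n.+1}, \dim U = q /\
    forall u, (u \in U) <-> (\sum_i u 0 i = 0 /\ forall i j, c i = c j -> u 0 i = u 0 j).
Proof.
move=> cs.
pose phi (t : 'rV[R]_q.+1) : 'rV[R]_n.+1 := \row_i t 0 (c i).
pose s (t : 'rV[R]_q.+1) : R^o := \sum_i t 0 (c i).
have lphi : linear phi by move=> a u w; apply/rowP => i; rewrite !mxE.
have ls : linear s.
  move=> a u w; rewrite /s; under eq_bigr do rewrite !mxE.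
  by rewrite big_split /= -mulr_sumr.
pose phiL := GRing.isLinear.Build R _ _ _ phi lphi.
pose Phi : {linear 'rV[R]_q.+1 -> 'rV[R]_n.+1} := HB.pack phi phiL.
pose sL := GRing.isLinear.Build R _ _ _ s ls.
pose S : {linear 'rV[R]_q.+1 -> R^o} := HB.pack s sL.
have sE t : linfun S t = s t := lfunE S t.
have phiE t : linfun Phi t = phi t := lfunE Phi t.
pose K := lker (linfun S).
have phi_inj : lker (linfun Phi) == 0%VS.
  apply/lker0P => u w; rewrite !phiE => e; apply/rowP => a.
  by have [i <-] := cs a; have /rowP/(_ i) := e; rewrite !mxE.
exists (linfun Phi @: K)%VS; split.
  rewrite limg_dim_eq; last by rewrite (eqP phi_inj) capv0.
  have := limg_ker_dim (linfun S) fullv; rewrite capfv -/K dimvf /dim /= mul1n.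
  suff -> : limg (linfun S) = fullv by rewrite dimvf /dim /= addn1 => -[].
  apply/eqP; rewrite eqEsubv subvf /=; apply/subvP => y _.
  apply/memv_imgP; exists (const_mx (y / n.+1%:R)); first exact: memvf.
  rewrite sE /s; under eq_bigr do rewrite mxE.
  by rewrite sumr_const card_ord -[RHS](@mulr_natr R) (@divfK R) // pnatr_eq0.
move=> u; split.
  case/memv_imgP => t tK ->; rewrite phiE; split.
    under eq_bigr do rewrite mxE.
    by move: tK; rewrite memv_ker sE => /eqP.
  by move=> i j cij; rewrite !mxE cij.
move=> [su hu]; pose t : 'rV[R]_q.+1 := \row_a u 0 (projT1 (cid (cs a))).
have tE : phi t = u.
  by apply/rowP => i; rewrite !mxE; apply: hu; case: (cid _).
apply/memv_imgP; exists t; last by rewrite phiE tE.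
rewrite memv_ker sE /s; apply/eqP; rewrite -[RHS]su -tE.
by apply: eq_bigr => i _; rewrite [RHS]mxE.
Qed.

Lemma mx_geD (R : realType) (k : local_field) (n : nat) (x : 'rV[R]_n) (r : R) (A B : 'M[k]_n) :
  mx_ge x r A -> mx_ge x r B -> mx_ge x r (A + B).
Proof. by move=> gA gB i j; rewrite mxE; exact: val_geD. Qed.

Lemma mx_geB (R : realType) (k : local_field) (n : nat) (x : 'rV[R]_n) (r : R) (A B : 'M[k]_n) :
  mx_ge x r A -> mx_ge x r B -> mx_ge x r (A - B).
Proof. by move=> gA gB; apply: mx_geD => // i j; rewrite mxE; exact: val_geN. Qed.

(** * Upper bound on the dimension *)

Definition row_ge (R : realType) (k : local_field) (n : nat) (x : 'rV[R]_n) (s : R)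
  (u : 'rV[k]_n) : Prop := forall j, val_ge (s + x 0 j) (u 0 j).
Definition row_gt (R : realType) (k : local_field) (n : nat) (x : 'rV[R]_n) (s : R)
  (u : 'rV[k]_n) : Prop := forall j, val_gt (s + x 0 j) (u 0 j).

Lemma row_ge_mul (R : realType) (k : local_field) (n : nat) (x : 'rV[R]_n) (s r : R)
    (u : 'rV[k]_n) (A : 'M[k]_n) :
  row_ge x s u -> mx_ge x r A -> row_ge x (s + r) (u *m A).
Proof.
move=> gu gA j; rewrite mxE; apply: val_ge_sum => l _.
by rewrite (_ : _ + _ = (s + x 0 l) + (r - x 0 l + x 0 j)); [exact: val_geM|lra].
Qed.

Lemma row_gt_mul (R : realType) (k : local_field) (n : nat) (x : 'rV[R]_n) (s r : R)
    (u : 'rV[k]_n) (A : 'M[k]_n) :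
  row_gt x s u -> mx_ge x r A -> row_gt x (s + r) (u *m A).
Proof.
move=> gu gA j; rewrite mxE; apply: val_gt_sum => l _.
by rewrite (_ : _ + _ = (s + x 0 l) + (r - x 0 l + x 0 j)); [exact: val_gt_geM|lra].
Qed.

(** Start from the basis vector of i0 and apply X repeatedly, discarding at each
    step the coordinates outside D: off the walls the bound on the entries of X
    is strict, so the discarded part is deeper. If no vector of the required
    kind occurred, the depth would increase by exactly r each time, and the
    m-th power of X would not vanish. *)
Lemma residual_kernel_vector (R : realType) (k : local_field) (n : nat) (x : 'rV[R]_n.+1) (r :
  R)
    (X : 'M[k]_n.+1) (D : pred 'I_n.+1) (i0 : 'I_n.+1) (m : nat) :
  mx_ge x r X -> X ^+ m = 0 -> D i0 ->
  (forall i j, D i -> ~~ D j -> ~ on_wall r x i j) ->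
  exists s : R, exists u : 'rV[k]_n.+1,
    [/\ forall j, ~~ D j -> u 0 j = 0, row_ge x s u, ~ row_gt x s u & row_gt x (s + r) (u *m
      X)].
Proof.
move=> gX Xm Di0 Dsep; apply: contrapT => none.
suff step j : exists u : 'rV[k]_n.+1,
    [/\ forall l, ~~ D l -> u 0 l = 0, row_ge x (j%:R * r - x 0 i0) u,
        ~ row_gt x (j%:R * r - x 0 i0) u &
        row_gt x (j%:R * r - x 0 i0) (u - delta_mx 0 i0 *m X ^+ j)].
  have [u [_ _ ngt]] := step m; rewrite Xm mulmx0 subr0; exact: ngt.
elim: j => [|j [u [uD gu ngu du]]].
  exists (delta_mx 0 i0); split.
  - by move=> l Dl; rewrite mxE eqxx /=; case: eqVneq => // li; move: Dl; rewrite li Di0.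
  - move=> l; rewrite mxE eqxx /=; case: eqVneq => [->|_]; last by left.
    by right; rewrite lf_val1 mul0r sub0r addNr.
  - move=> /(_ i0); rewrite mxE !eqxx /= => -[/eqP|]; first by rewrite oner_eq0.
    by rewrite lf_val1 mul0r sub0r addNr ltxx.
  - by rewrite expr0 (_ : delta_mx 0 i0 *m 1 = delta_mx 0 i0); [rewrite subrr => l;
      rewrite mxE; left|exact: mulmx1].
set s := j%:R * r - x 0 i0 in gu ngu du.
have s'E : j.+1%:R * r - x 0 i0 = s + r by rewrite /s -natr1; lra.
rewrite s'E.
pose u' : 'rV[k]_n.+1 := \row_l if D l then (u *m X) 0 l else 0.
have dE (a b : 'rV[k]_n.+1) l : (a - b) 0 l = a 0 l - b 0 l by rewrite mxE [X in _ + X]mxE.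
have u'E l : u' 0 l = if D l then (u *m X) 0 l else 0 by rewrite mxE.
have u'X : row_gt x (s + r) (u' - u *m X).
  move=> l; rewrite dE u'E.
  case: ifPn => Dl; first by rewrite subrr; left.
  rewrite sub0r; apply: val_gtN; rewrite mxE; apply: val_gt_sum => i _.
  case Di : (D i); last by rewrite uD ?Di // mul0r; left.
  rewrite (_ : s + r + x 0 l = (s + x 0 i) + (r - x 0 i + x 0 l)); last by lra.
  apply: val_ge_gtM (gu i) _; have [->|lt] := gX i l; first by left.
  right; rewrite lt_neqAle lt andbT; apply/eqP => e; apply: (Dsep i l) => //.
  by exists (lf_val (X i l)); rewrite /aff_eval /= -e; lra.
exists u'; split.
- by move=> l /negPf Dl; rewrite u'E Dl.
- move=> l; rewrite u'E; case: ifP => _; last by left.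
  exact: row_ge_mul gu gX l.
- move=> gu'; apply: none; exists s, u; split=> // l.
  rewrite -[(u *m X) 0 l](subKr (u' 0 l)); apply: val_gtD (gu' l) _.
  by apply: val_gtN; have := u'X l; rewrite dE.
- rewrite exprSr mulmxA -[u' - _](subrKA (u *m X)) -mulmxBl => l.
  by rewrite mxE; apply: val_gtD (u'X l) _; exact: row_gt_mul du gX l.
Qed.

(** Multiplying 1 + X M by a factor 1 - c X Y only changes M by terms of
    depth -r. *)
Lemma kernel_corrector_integral (R : realType) (k : local_field) (n : nat) (x : 'rV[R]_n.+1)
  (r : R)
    (Y X : 'M[k]_n.+1) :
  (forall m, (0 < m <= n)%N -> m%:R != 0 :> k /\ lf_val (m%:R : k) = 0) ->
  mx_ge x r X -> mx_ge x (- r) Y ->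
  exists2 M : 'M[k]_n.+1, mx_ge x (- r) M & kernel_corrector Y X = 1 + X *m M.
Proof.
move=> hk gX gY; rewrite /kernel_corrector; elim/big_rec: _ => [|ab B _ [M gM ->]].
  by exists 0; [move=> i j; rewrite mxE; left|rewrite mulmx0 addr0].
set c := (_%:R)^-1.
have gc : val_ge (0 : R) c.
  have [a0 va] := hk ab.1.+1 (ltn_ord ab.1); have [b0 vb] := hk ab.2.+1 (ltn_ord ab.2).
  by rewrite /c natrM; right; rewrite lf_valV ?mulf_neq0 // lf_valM // va vb.
have gZ A : mx_ge x (- r) A -> mx_ge x (- r) (c *: A).
  by move=> gA i j; rewrite mxE -[_ + _]add0r; exact: val_geM.
exists (M - c *: (Y + Y *m X *m M)).
  apply: mx_geB => //; apply: gZ; apply: mx_geD => //; rewrite -[- r]add0r -(addNr r).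
  by apply: mx_geM => //; exact: mx_geM.
rewrite -[LHS]/(_ *m _) mulmxBl mul1mx mulmxDr [_ *m 1]mulmx1 mulmxBr -scalemxAr mulmxDr
  !mulmxA.
by rewrite -!scalemxAl -scalerDr addrA.
Qed.

(** The rows of W are the residual kernel vectors of the q components. Since
    the corrector maps into ker X, it is enough that W times the corrector has
    independent rows. In a relation with coefficients v, consider a component
    a0 for which val (v_a) + s_a is minimal: the correction is deeper than this
    level, so the coordinates of v W in that component would be deeper too,
    which contradicts the choice of the vector of a0. *)
Lemma component_count_le (R : realType) (k : local_field) (n q : nat) (x : 'rV[R]_n.+1) (r : R)
    (Y H X : 'M[k]_n.+1) (c : 'I_n.+1 -> 'I_q) :
  small_units k (n.+1).*2 ->
  (forall m, (0 < m <= n)%N -> m%:R != 0 :> k /\ lf_val (m%:R : k) = 0) ->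
  lie_triple Y H X -> mx_ge x r X -> mx_ge x (- r) Y ->
  (forall a, exists i, c i = a) ->
  (forall i j, on_wall r x i j -> c i = c j) ->
  (q <= n.+1 - \rank X)%N.
Proof.
move=> hF hk T gX gY cs cw; pose f0 := kernel_corrector Y X.
have [M gM f0E] := kernel_corrector_integral hk gX gY.
have /choice[sw swP] (a : 'I_q) : exists sw : R * 'rV[k]_n.+1,
    [/\ forall j, c j != a -> sw.2 0 j = 0, row_ge x sw.1 sw.2, ~ row_gt x sw.1 sw.2
      & row_gt x (sw.1 + r) (sw.2 *m X)].
  have [i0 ci0] := cs a.
  have := @residual_kernel_vector R k n x r X (fun i => c i == a) i0 n.+1 gX (lie_triple_nilX
    hF T).
  rewrite ci0 eqxx => /(_ isT) [|s [u [? ? ? ?]]]; last by exists (s, u).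
  by move=> i j /eqP <- ji /cw e; case/eqP: ji.
pose s a := (sw a).1; pose w a := (sw a).2.
pose W := \matrix_a w a.
have rW a : row a W = w a by rewrite rowK.
suff : row_free (W *m f0).
  move=> /eqP <-; rewrite -mxrank_ker; apply: mxrankS.
  by apply/sub_kermxP; rewrite -mulmxA /f0 (kernel_correctorX hF T) mulmx0.
apply: inj_row_free => v vW; apply/eqP/negPn/negP => /rV0Pn[a1 va1].
pose lev a : R := (lf_val (v 0 a))%:~R + s a.
have [a0 va0 amin] : exists2 a0, v 0 a0 != 0 & forall a, v 0 a != 0 -> lev a0 <= lev a.
  pose a0 := [arg min_(a < a1 | v 0%R a != 0%R) lev a]%O.
  by exists a0; rewrite /a0; case: Order.TotalTheory.arg_minP.
(* The relation v W f0 = 0 with f0 = 1 + X M. *)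
have vWE : v *m W = - (v *m W *m X *m M).
  by move/eqP: vW; rewrite mulmxA /f0 f0E mulmxDr [_ *m 1]mulmx1 mulmxA addr_eq0 => /eqP.
have gtX : row_gt x (lev a0 + r) (v *m W *m X).
  rewrite -mulmxA mulmx_sum_row => j; rewrite summxE; apply: val_gt_sum => a _.
  rewrite row_mul rW mxE; have [->|va] := eqVneq (v 0 a) 0; first by rewrite mul0r; left.
  have [_ _ _ /(_ j) h] := swP a.
  have := val_ge_gtM (or_intror (lexx _) : val_ge (lf_val (v 0 a))%:~R (v 0 a)) h.
  case=> [->|lt]; [by left|right]; apply: le_lt_trans lt.
  by have := amin a va; rewrite /lev -/(s a); lra.
have gtW : row_gt x (lev a0) (v *m W).
  rewrite vWE => j; rewrite mxE; apply: val_gtN.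
  by have := row_gt_mul gtX gM j; rewrite addrK.
have [w0 _ ngt _] := swP a0; apply: ngt => j.
have [cj|/w0 ->] := eqVneq (c j) a0; last by left.
have := gtW j; rewrite mulmx_sum_row summxE (bigD1 a0) //= big1 => [|a aa0]; last first.
  rewrite rW mxE; have [wa _ _ _] := swP a.
  by rewrite [w a 0 j]wa ?mulr0 // cj eq_sym.
rewrite addr0 rW mxE -/(w a0) => -[/eqP|].
  by rewrite mulf_eq0 (negPf va0) /= => /eqP ->; left.
have [->|wj] := eqVneq (w a0 0 j) 0; first by left.
by rewrite lf_valM // intrD /lev -/(s a0) => h; right; lra.
Qed.

(** * Lower bound on the dimension *)

(** In a chain basis the nonzero entries of X join consecutive vectors of a
    chain, so that the norms decreasing by r along the chains satisfy both depth
    conditions, with equality for X. *)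
Lemma adapted_apartment (R : realType) (k : local_field) (n : nat) (r : R) (Y H X :
  'M[k]_n.+1) :
  small_units k (n.+1).*2 -> lie_triple Y H X ->
  exists h : 'M[k]_n.+1, exists blk : 'I_n.+1 -> 'I_(n.+1 - \rank X), exists o : 'rV[R]_n.+1,
  [/\ SL k n.+1 h, forall a, exists i, blk i = a,
      forall i j, Ad h X i j = 0 \/ (blk i = blk j /\ val_ge (r - o 0 i + o 0 j) (Ad h X i j)) &
      forall i j, Ad h Y i j = 0 \/ (blk i = blk j /\ val_ge (- r - o 0 i + o 0 j) (Ad h Y i
        j))].
Proof.
move=> hF T; have [P [blk [pos [cy [Pu bs PX PY _]]]]] := chain_basis hF T.
have dP : \det P != 0 by rewrite -unitfE -unitmxE.
(* Rescaling one basis vector makes the determinant 1; the valuations of d enter o. *)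
pose d (i : 'I_n.+1) : k := if i == ord0 then (\det P)^-1 else 1.
have d0 i : d i != 0 by rewrite /d; case: ifP; rewrite ?invr_eq0 ?oner_neq0.
pose D := diag_mx (\row_i d i); pose h := D *m P.
have dh : SL k n.+1 h.
  rewrite /SL /= det_mulmx det_diag (bigD1 ord0) //= big1 => [|i /negPf i0].
    by rewrite mxE /d eqxx mulr1 mulVf.
  by rewrite mxE /d i0.
have hu := SL_unitmx dh.
have AdE (A A' : 'M[k]_n.+1) : P *m A = A' *m P ->
    forall i j, Ad h A i j = d i * A' i j / d j.
  move=> PA i j; pose B := \matrix_(i, j) (d i * A' i j / d j).
  suff -> : Ad h A = B by rewrite mxE.
  apply: (can_inj (mulmxK hu)); rewrite /Ad mulmxKV // /h mulmxA -mulmxA PA !mulmxA.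
  congr (_ *m _); apply/matrixP => a b.
  by rewrite mul_diag_mx mul_mx_diag !mxE mulfVK.
pose o : 'rV[R]_n.+1 := \row_i (- (lf_val (d i))%:~R - (pos i)%:R * r).
exists h, blk, o; split=> // i j.
  rewrite (AdE _ _ PX) mxE; case: andP => [[/eqP bij /eqP pij]|_]; last first.
    by left; rewrite mulr0 mul0r.
  right; split=> //; right; rewrite mulr1 lf_valM ?invr_eq0 // lf_valV // intrD rmorphN /=.
  by rewrite !mxE pij -natr1; lra.
rewrite (AdE _ _ PY) mxE; case: andP => [[/eqP bij /eqP pij]|_]; last first.
  by left; rewrite mul0n mulr0 mul0r.
right; split=> //; rewrite mul1n.
have -> : - r - o 0 i + o 0 j = (lf_val (d i))%:~R + 0 + (lf_val (d j)^-1)%:~R :> R.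
  by rewrite !mxE -pij -natr1 lf_valV // rmorphN /=; lra.
by apply: val_geM; [apply: val_geM; [right|exact: val_ge_nat]|right].
Qed.

(** Separating the blocks by a small multiple e of their indices moves the point
    off every wall between two blocks; tau restores the zero sum. *)
Lemma generic_point (R : realType) (n l : nat) (r : R) (o : 'rV[R]_n.+1) (blk : 'I_n.+1 ->
  'I_l) :
  exists y : 'rV[R]_n.+1, [/\ apartment R n.+1 y,
    forall i j, blk i = blk j -> y 0 i - y 0 j = o 0 i - o 0 j &
    forall i j, on_wall r y i j -> blk i = blk j].
Proof.
pose b i : R := (blk i : nat)%:R.
have P : \forall e \near (0 : R)^'+, forall ij : 'I_n.+1 * 'I_n.+1, forall m : int,
    o 0 ij.1 - o 0 ij.2 - r + m%:~R != 0 ->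
    (0 < o 0 ij.1 - o 0 ij.2 - r + m%:~R + e * (b ij.1 - b ij.2)) =
    (0 < o 0 ij.1 - o 0 ij.2 - r + m%:~R) /\
    o 0 ij.1 - o 0 ij.2 - r + m%:~R + e * (b ij.1 - b ij.2) != 0.
  near=> e; near: e; apply: filter_forall => ij; exact: perturb.
near (0 : R)^'+ => e.
have e0 : 0 < e by near: e; exact: nbhs_right_gt.
have he : forall ij : 'I_n.+1 * 'I_n.+1, forall m : int,
    o 0 ij.1 - o 0 ij.2 - r + m%:~R != 0 ->
    (0 < o 0 ij.1 - o 0 ij.2 - r + m%:~R + e * (b ij.1 - b ij.2)) =
    (0 < o 0 ij.1 - o 0 ij.2 - r + m%:~R) /\
    o 0 ij.1 - o 0 ij.2 - r + m%:~R + e * (b ij.1 - b ij.2) != 0.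
  by near: e; exact: P.
pose tau := (\sum_i (o 0 i + e * b i)) / n.+1%:R.
exists (\row_i (o 0 i + e * b i - tau)); split.
- rewrite /apartment /=; under eq_bigr do rewrite mxE.
  rewrite sumrB sumr_const card_ord -mulr_natr /tau divfK ?subrr // pnatr_eq0 //.
- by move=> i j bij; rewrite !mxE /b bij; lra.
- move=> i j [m]; rewrite /aff_eval !mxE /= => em.
  have [f0|f0] := eqVneq (o 0 i - o 0 j - r + m%:~R) 0.
    have : e * (b i - b j) = 0 by lra.
    move/eqP; rewrite mulf_eq0 (gt_eqF e0) /= subr_eq0 eqr_nat => /eqP h.
    exact: val_inj.
  by have [_ /eqP[]] := he (i, j) m f0; rewrite /=; lra.
Unshelve. all: by end_near.
Qed.

Lemma face_components (R : realType) (n : nat) (r : R) (x : 'rV[R]_n.+1) :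
  exists q, exists c : 'I_n.+1 -> 'I_q.+1, exists U : {vspace 'rV[R]_n.+1},
    [/\ forall a, exists i, c i = a,
        forall i j, on_wall r x i j -> c i = c j,
        forall (T : Type) (f : 'I_n.+1 -> T), (forall i j, on_wall r x i j -> f i = f j) ->
          forall i j, c i = c j -> f i = f j,
        face_space r x U & \dim U = q].
Proof.
have [q [c [cs ce cf]]] := generated_quotient (fun i j => `[< on_wall r x i j >]).
have [U [dU hU]] := @sum0_fiber_space R n q r x c cs.
exists q, c, U; split=> //.
- by move=> i j h; apply: ce; apply/asboolP.
- by move=> T f hf; apply: cf => i j /asboolP; exact: hf.
- move=> u; split=> [/hU[su h]|[su h]].
    by split=> // i j _ w; apply: h; apply: ce; apply/asboolP.
  apply/hU; split=> //; apply: cf => i j /asboolP w.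
  by have [->|ij] := eqVneq i j => //; exact: h.
Qed.

(** The surjection blk factors through c. *)
Lemma factor_surj_leq (n l q : nat) (blk : 'I_n -> 'I_l) (c : 'I_n -> 'I_q) :
  (forall a, exists i, blk i = a) -> (forall i j, c i = c j -> blk i = blk j) -> (l <= q)%N.
Proof.
move=> bs h; have /choice[f fP] := bs.
have /leq_card : injective (c \o f) by move=> a b /h; rewrite !fP.
by rewrite !card_ord.
Qed.

(** * The dimension of a distinguished facet *)

Lemma adapted_triple_lie (R : realType) (k : local_field) (n : nat) (x : 'rV[R]_n) (r : R)
    (v : set 'M[k]_n) (Y H X : 'M[k]_n) :
  adapted_triple x r v Y H X -> lie_triple Y H X.
Proof.
case=> [[_ [-> -> ->]]|[_ [//]]].
by split; rewrite /lie_br !mulmx0 ?mul0rn ?subrr ?oppr0.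
Qed.

(** The generalized facet of a generic point of the chain apartment: it has at
    least one component per chain, and the depth condition on Y, which is at
    level -r, is preserved along it by duality. *)
Lemma large_facet_in_locus (R : realType) (k : local_field) (n : nat) (r : R) (Y H X :
  'M[k]_n.+1) :
  small_units k (n.+1).*2 -> lf_val (n.+1%:R : k) = 0 -> lie_triple Y H X -> \tr X = 0 ->
    \tr Y = 0 ->
  exists C : set (building_pt R k n.+1), exists d : nat,
    [/\ gen_facet r C, C `<=` triple_locus r Y H X, gen_facet_dim C d &
        (n.+1 - \rank X <= d.+1)%N].
Proof.
move=> hF vn T trX trY.
have n0 : n.+1%:R != 0 :> k by apply: hF; lia.
have [h [blk [ o [dh bs hX hY]]]] := adapted_apartment r hF T.
have [y [ay yo yw]] := generic_point r o blk.
have hu := SL_unitmx dh; pose g := invmx h; have dg : SL k n.+1 g by exact: SL_inv.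
have fX : filt k y r (Ad h X).
  apply/filtE; split=> [|i j]; first by rewrite /sl /= Ad_tr.
  have [->|[/yo yij]] := hX i j; first by left.
  by rewrite (_ : r - o 0 i + o 0 j = r - y 0 i + y 0 j) //; lra.
have fY : filt k y (- r) (Ad h Y).
  apply/filtE; split=> [|i j]; first by rewrite /sl /= Ad_tr.
  have [->|[/yo yij]] := hY i j; first by left.
  by rewrite (_ : - r - o 0 i + o 0 j = - r - y 0 i + y 0 j) //; lra.
pose C := [set z | [/\ building R k n.+1 z, bfilt z r = bfilt (bpoint g y) r &
                     bfilt_plus z r = bfilt_plus (bpoint g y) r]].
have Cy : C (bpoint g y) by split=> //; exists g, y.
have gC : gen_facet r C by exists (bpoint g y) => //; exists g, y.
have [q [c [U [cs cw cf fU dU]]]] := face_components r y.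
exists C, q; split=> //.
- move=> z [bz ez epz]; split=> //; last first.
    by rewrite ez bfiltE //; exists (Ad h X) => //; exact: AdK.
  have [g' [w [dg' aw zE]]] := bz; rewrite zE in epz *.
  apply: (@bfilt_dual R k n.+1 g g' y w r) => //; first by rewrite epz.
  by rewrite bfiltE //; exists (Ad h Y) => //; exact: AdK.
- exists g; rewrite (apt_section_same_side gC dg ay Cy); split=> //; first by exists y; split.
  by rewrite -dU; exact: same_side_has_dim.
- exact: (factor_surj_leq bs (cf _ _ yw)).
Qed.

Lemma large_prime (p m : nat) : prime p -> (0 < m)%N -> (3 * m < p)%N -> (m.+1.*2 < p)%N.
Proof.
(* For m = 1 the inequality 3 < p leaves p = 4, excluded by primality alone. *)
move=> pp m0 h; have : p != 4%N by apply: contraL pp => /eqP ->.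
lia.
Qed.

Theorem corollary4p3 (R : realType) (k : local_field)
    (K : closedFieldType) (iota : {rmorphism k -> K})
    (iota_alg : forall z : K, algebraicOver iota z)
    (n : nat) (n_ge2 : (2 <= n)%N)
    (p : nat) (p_char : p \in [pchar (residue k)])
    (p_large : (3 * (n - 1) < p)%N)
    (r : R) (lam : seq nat) (lam_part : is_partition lam n)
    (F : set 'rV[R]_n) (v : set 'M[k]_n)
    (Fv_dist : distinguished_pair r F v)
    (Fv_orbit : pair_orbit r F v `<=` orbit_part_rat iota n lam) :
  has_dim F (size lam).-1.
Proof.
have pp : prime p by case/andP: p_char.
case: n n_ge2 p_large lam_part F v Fv_dist Fv_orbit => // n n1.
rewrite subSS subn0 => p_large lam_part F v [[rF _] [x [Y [H [X [Fx ad [C [FC [gC CB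
  Cmax]]]]]]]]] orb.
have p2 := large_prime pp n1 p_large.
have hF : small_units k n.+1.*2.
  by move=> m /andP[m0 mn]; have [] := small_nat_unit p_char (_ : (0 < m < p)%N);
    rewrite ?m0 ?(leq_ltn_trans mn).
have hk m : (0 < m <= n)%N -> m%:R != 0 :> k /\ lf_val (m%:R : k) = 0.
  by move=> /andP[m0 mn]; apply: small_nat_unit p_char _; lia.
have vn : lf_val (n.+1%:R : k) = 0.
  by have [] := small_nat_unit p_char (_ : (0 < n.+1 < p)%N) => //; lia.
have T := adapted_triple_lie ad.
have [ax sub] := same_side_sub_r_facet rF Fx.
have d1 : SL k n.+1 1%:M by rewrite /SL /= det1.
have Cx : C (bpoint 1%:M x) by apply: FC; exists x.
have ell : (n.+1 - \rank X)%N = size lam.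
  apply: (orbit_part_rank lam_part (orb X _)).
  by exists x, Y, H, X, 1%:M; split=> //; rewrite Ad1.
have [_ bY bX] := CB _ Cx.
have {}bX : filt k x r X by move: bX; rewrite bfiltE // => -[A + <-]; rewrite Ad1.
have {}bY : filt k x (- r) Y by move: bY; rewrite bfiltE // => -[A + <-]; rewrite Ad1.
have [trX gX] := (filtE _ _ _).1 bX; have [trY gY] := (filtE _ _ _).1 bY.
have [q [c [U [cs cw _ fU dU]]]] := face_components r x.
have secC := apt_section_same_side gC d1 ax Cx.
have FE : F = same_side r x.
  rewrite eqEsubset; split=> // z Fz; rewrite -secC; split; last by apply: FC; exists z.
  by have [] := same_side_sub_r_facet rF Fz.
have dF : has_dim F q by rewrite FE -dU; exact: same_side_has_dim.
have up : (q.+1 <= size lam)%N by rewrite -ell; exact: component_count_le hF hk T gX gY cs cw.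
have [C' [d' [gC' C'B dC']]] := large_facet_in_locus r hF vn T trX trY; rewrite ell => low.
have qd : (d' <= q)%N.
  apply: (Cmax C' gC' C'B) dC'; exists 1%:M; split=> //; rewrite secC -?FE //.
  by exists x.
by rewrite (_ : (size lam).-1 = q) //; lia.
Qed.
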